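(* Let $P\in\mathcal{P}(\mathbb{R}^d)$ have Lebesgue density $p$, let $K$, $h_N$ and $p$ satisfy the conditions (i)--(iii) of the context, and let $Z_1,\dots,Z_N$ be generated by a Markov chain $(Z_k)_{k\in\mathbb{N}}$ satisfying the Markov chain and kernel conditions of the context (including (SSC), (DC), and (KMC) with drift function $V$ and constants $B_1,B_2,B_4$). Let $$\hat q_N=\frac1N\sum_{k=1}^NK_h(Z_k,\cdot),\qquad K_h(x,y)=\frac1{h^d}K\Bigl(\frac{x-y}h\Bigr).$$ Then there exist constants $\alpha_0,\alpha_1>0$ (not depending on $N$, $h$) such that, for every $N\in\mathbb{N}$ and any bandwidth $0<h\le1$, $$\int_{\mathbb{R}^d}\mathbb{E}\Bigl[\bigl|\hat q_N(x)-\mathbb{E}_P[K_h(x,\cdot)]\bigr|\Bigr]\mathrm{d}x\le\frac{\alpha_0\|K\|_{L^1(\mathbb{R}^d)}}{\sqrt N}+\frac{\alpha_0B_1}{\sqrt N\,h^d}+\frac{2\alpha_1\|K\|_{L^2(\mathbb{R}^d)}^2}{Nh^d}+\frac{2\alpha_1B_2}{Nh^{2d}},$$ $$\int_{\mathbb{R}^d}\mathbb{E}\Bigl[\bigl(\hat q_N(x)-\mathbb{E}_P[K_h(x,\cdot)]\bigr)^2\Bigr]\mathrm{d}x\le\frac{4\alpha_0^2\|K\|_{L^2(\mathbb{R}^d)}^2}{Nh^d}+\frac{4\alpha_0^2B_2}{Nh^{2d}}+\frac{8\alpha_1^2\|K\|_{L^4(\mathbb{R}^d)}^4}{N^2h^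{3d}}+\frac{8\alpha_1^2B_4}{N^2h^{4d}}.$$
   Context: Conditions on kernel, bandwidth and density: (i) $K:\mathbb{R}^d\to[0,\infty)$, $K\in L^1(\mathbb{R}^d)\cap L^2(\mathbb{R}^d)$, $\int K(u)\,\mathrm{d}u=1$, $\int uK(u)\,\mathrm{d}u=0$, $\int\|u\|^2|K(u)|\,\mathrm{d}u<\infty$. (ii) The bandwidth $h_N>0$ satisfies $h_N\to0$ and $Nh_N^d\to\infty$ as $N\to\infty$. (iii) $p\in W^{2,1}(\mathbb{R}^d)\cap W^{2,2}(\mathbb{R}^d)$, i.e. $p$ and its weak derivatives up to order 2 are integrable and square-integrable. Standing assumption: $p$ is strictly positive. For a transition kernel $T$ and measurable $g$, $T[g](x)=\int g(y)\,T(x,\mathrm{d}y)$. $\mathbb{E}_\mu[g]=\int g\,\mathrm{d}\mu$ for a probability measure $\mu$. Markov chain and kernel conditions: $(Z_k)_{k\in\mathbb{N}}$ is a Markov chain in $\mathbb{R}^d$ with $Z_1\sim\mu_1\in\mathcal{P}(\mathbb{R}^d)$, time-homogeneous transition kernel $T$ and invariant distribution $P$ such that $T$ is $P$-irreducible, aperiodic and Harris recurrent. Moreover: (SSC) Small set condition: there exist a Borel set $J$ with $P(J)>0$, a constant $\beta>0$ and $\nu\in\mathcal{P}(\mathbb{R}^d)$ such that $T(x,A)\ge\beta\nu(A)$ for all $x\in J$ and all Borel sets $A\subseteq\mathbb{R}^d$. (DC) Drift condition: there exist $V:\mathbb{R}^d\to[1,\infty)$ and constants $\lambda\in(0,1)$,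 $b>0$ such that for all $x\in\mathbb{R}^d$, $T[V](x)\le\lambda V(x)\mathbf{1}_{\{x\notin J\}}+b\,\mathbf{1}_{\{x\in J\}}$, with $J$ from (SSC). Moreover $\mathbb{E}_{\mu_1}[V]\le\frac b{1-\lambda}$. (KMC) Kernel moment condition: $K\in L^4(\mathbb{R}^d)$, and for all $r\in\{1,2,4\}$ there is a constant $B_r=B_r(V,K)>0$ such that for every $0<h\le1$, $$\int_{\mathbb{R}^d}\sup_{y\in\mathbb{R}^d}|K_h(x,y)|^rV^{-r/2}(y)\,\mathrm{d}x\le\frac{B_r}{h^{rd}}.$$
   Formalization: The estimator is taken as (1/N) Σ K_h(x, Z_k) instead of (1/N) Σ K_h(Z_k, x); the two agree for even K, while for non-even K the literal version is biased and the bounds fail as N grows. *)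

(* Defs.v *)
From HB Require Import structures.
From mathcomp Require Import all_boot all_order all_algebra.
From mathcomp Require Import all_classical all_reals all_analysis.
From mathcomp Require Import measurable_realfun.

Set Implicit Arguments.
Unset Strict Implicit.
Unset Printing Implicit Defensive.

Import Order.TTheory GRing.Theory Num.Theory.
Import numFieldNormedType.Exports.

Local Open Scope classical_set_scope.
Local Open Scope ring_scope.

Definition rV_display : measure_display.
Proof. exact: default_measure_display.
Qed.

HB.instance Definition rV_isMeasurable (R : realType) (d : nat) :
  isMeasurable rV_display 'rV[R]_d :=
  @isMeasurable.Build rV_display 'rV[R]_d <<s (@open 'rV[R]_d) >>
    (@sigma_algebra0 _ setT _) (@sigma_algebraC _ _)
    (@sigma_algebra_bigcup _ setT _).

Section borel_rV.
Context {R : realType} (d : nat).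

Lemma open_measurable_rV (U : set 'rV[R]_d) : open U -> measurable U.
Proof. by move=> oU; apply: sub_sigma_algebra. Qed.

Lemma measurable_coord (i : 'I_d) :
  measurable_fun setT (fun v : 'rV[R]_d => v ord0 i).
Proof.
apply: (measurability _ (RGenOpens.measurableE R)) => _ [_ [a [b ->] <-]].
rewrite setTI; apply: open_measurable_rV.
apply: open_comp; last exact: interval_open.
by move=> v _; exact: coord_continuous.
Qed.

Lemma open_rV_bigcup (U : set 'rV[R]_d) : open U ->
  U = \bigcup_(qn in [set qn : 'rV[rat]_d * nat |
         ball (map_mx ratr qn.1 : 'rV[R]_d) qn.2.+1%:R^-1 `<=` U])
        ball (map_mx ratr qn.1 : 'rV[R]_d) qn.2.+1%:R^-1.
Proof.
move=> oU; apply/seteqP; split=> [x Ux|x [qn /= + Bx]]; last exact.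
have /nbhs_ballP[e /= e0 xeU] : nbhs x U by exact: open_nbhs_nbhs.
have [n ne] : exists n, n.+1%:R^-1 < e / 2 :> R.
  have e20 : 0 < e / 2 by exact: divr_gt0.
  exists (Num.trunc (e / 2)^-1).
  by rewrite invf_plt ?posrE// ?truncnS_gt.
have n0 : 0 < n.+1%:R^-1 :> R by rewrite invr_gt0.
have Hq i : exists q : rat, `|ratr q - x ord0 i| < n.+1%:R^-1.
  have [q] := @rat_in_itvoo R (x ord0 i) (x ord0 i + n.+1%:R^-1) (ltac:(by rewrite ltrDl)).
  rewrite in_itv/= => /andP[q1 q2]; exists q.
  by rewrite ger0_norm ?subr_ge0 1?ltW// ltrBlDl.
pose q := \row_i projT1 (cid (Hq i)).
have qx : ball (map_mx ratr q : 'rV[R]_d) n.+1%:R^-1 x.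
  split=> // i j; rewrite !mxE (ord1 i).
  by case: cid => /= ?; rewrite /ball /=.
exists (q, n) => //= y qy; apply: xeU.
apply: (@le_ball _ _ _ (n.+1%:R^-1 + n.+1%:R^-1)).
  by rewrite [leRHS]splitr lerD// ltW.
exact: ball_triangle (ball_sym qx) qy.
Qed.

Lemma measurable_fun_rV d' (T : measurableType d') (f : T -> 'rV[R]_d) :
  (forall i, measurable_fun setT (fun t => f t ord0 i)) ->
  measurable_fun setT f.
Proof.
move=> mf; apply: (@measurability _ _ _ _ _ _ (@open 'rV[R]_d)) => //.
move=> _ [U oU <-]; rewrite setTI (open_rV_bigcup oU) preimage_bigcup.
rewrite bigcup_mkcond; apply: countable_bigcupT_measurable => //.
move=> [q n] /=; case: ifPn => // _.
rewrite (_ : _ @^-1` _ = \bigcap_(i in [set: 'I_d])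
  ((fun t => f t ord0 i) @^-1` ball (ratr (q ord0 i) : R) n.+1%:R^-1)); last first.
  apply/seteqP; split => [t [_ Bt] i _ /=|t Bt].
    by have := Bt ord0 i; rewrite mxE.
  split => [|i j]; first by rewrite invr_gt0.
  rewrite (ord1 i) mxE; exact: Bt.
apply: fin_bigcap_measurable => // i _.
rewrite -[X in measurable X]setTI; apply: mf => //.
exact: measurable_ball.
Qed.

End borel_rV.

Section lebesgue_rV.
Context {R : realType}.

Definition cons_rV n (p : R * 'rV[R]_n) : 'rV[R]_(1 + n) :=
  row_mx (const_mx p.1) p.2.

Lemma measurable_cons_rV n : measurable_fun setT (@cons_rV n).
Proof.
apply: measurable_fun_rV => i; rewrite /cons_rV.
case: (split_ordP i) => j ->.
  under eq_fun do rewrite row_mxEl mxE.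
  exact: measurable_fst.
under eq_fun do rewrite row_mxEr.
apply: (@measurableT_comp _ _ _ _ _ _ (fun v : 'rV[R]_n => v ord0 j)) => //.
exact: measurable_coord.
Qed.

Definition uncons_rV n (v : 'rV[R]_(1 + n)) : R * 'rV[R]_n :=
  (v ord0 ord0, rsubmx v).

Lemma cons_rVK n : cancel (@cons_rV n) (@uncons_rV n).
Proof.
move=> [x v]; rewrite /uncons_rV /cons_rV row_mxKr; congr pair.
by rewrite (_ : ord0 = lshift n (ord0 : 'I_1)) ?row_mxEl ?mxE//; exact: val_inj.
Qed.

Lemma cons_rV0 n (p : R * 'rV[R]_n) : cons_rV p ord0 ord0 = p.1.
Proof. by rewrite -[in RHS](cons_rVK p). Qed.

Lemma cons_rVS n (p : R * 'rV[R]_n) (i : 'I_n) :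
  cons_rV p ord0 (lift ord0 i) = p.2 ord0 i.
Proof.
rewrite (_ : lift ord0 i = rshift 1 i); last exact: val_inj.
by rewrite /cons_rV row_mxEr.
Qed.

Lemma measurable_uncons_rV n : measurable_fun setT (@uncons_rV n).
Proof.
apply/measurable_fun_pairP; split; first exact: measurable_coord.
apply: measurable_fun_rV => i.
by under eq_fun do rewrite /= mxE; exact: measurable_coord.
Qed.

(* R^(n+1) is identified with R * R^n *)
Section lebesgue_cons.
Context (n : nat) (m : {sigma_finite_measure set 'rV[R]_n -> \bar R}).
Local Open Scope ereal_scope.

Definition lebesgue_cons : set 'rV[R]_n.+1 -> \bar R :=
  pushforward ((@lebesgue_measure R) \x m) (@cons_rV n).

Let mcons : measurable_fun setT (@cons_rV n) := measurable_cons_rV (n:=n).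

Let lebesgue_cons0 : lebesgue_cons set0 = 0.
Proof. by rewrite /lebesgue_cons /pushforward preimage_set0 measure0. Qed.

Let lebesgue_cons_ge0 A : 0 <= lebesgue_cons A.
Proof. exact: measure_ge0. Qed.

Let lebesgue_cons_sigma_additive : semi_sigma_additive lebesgue_cons.
Proof.
exact: (@measure_semi_sigma_additive _ _ _ (pushforward _ _ : measure _ _)).
Qed.

HB.instance Definition _ := isMeasure.Build _ _ _ lebesgue_cons
  lebesgue_cons0 lebesgue_cons_ge0 lebesgue_cons_sigma_additive.

Let lebesgue_cons_sigma_finite : sigma_finite setT lebesgue_cons.
Proof.
have /sigma_finiteP[F [TF ndF Foo]] := sigma_finiteT (@lebesgue_measure R).
have /sigma_finiteP[G [TG ndG Goo]] := sigma_finiteT m.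
exists (fun k => @uncons_rV n @^-1` (F k `*` G k)).
  apply/seteqP; split => // v _.
  have [k _ Fk] : (\bigcup_k F k) (uncons_rV v).1 by rewrite -TF.
  have [l _ Gl] : (\bigcup_k G k) (uncons_rV v).2 by rewrite -TG.
  exists (maxn k l) => //; split.
    by move: Fk; exact/subsetPset/ndF/leq_maxl.
  by move: Gl; exact/subsetPset/ndG/leq_maxr.
move=> k; have [mF Fk] := Foo k; have [mG Gk] := Goo k; split.
  rewrite -[X in measurable X]setTI; apply: measurable_uncons_rV => //.
  exact: measurableX.
rewrite /lebesgue_cons /pushforward -comp_preimage.
rewrite (_ : _ \o _ = id) ?preimage_id; last first.
  by apply/funext => p /=; rewrite cons_rVK.
by rewrite product_measure1E// lte_mul_pinfty// ge0_fin_numE.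
Qed.

HB.instance Definition _ := Measure_isSigmaFinite.Build _ _ _ lebesgue_cons
  lebesgue_cons_sigma_finite.

End lebesgue_cons.

Fixpoint lebesgue_rV (d : nat) : {sigma_finite_measure set 'rV[R]_d -> \bar R} :=
  if d is n.+1 then lebesgue_cons (lebesgue_rV n) else \d_(0 : 'rV[R]_0).

Lemma lebesgue_rV_box d (A : 'I_d -> set R) : (forall i, measurable (A i)) ->
  lebesgue_rV d [set v : 'rV[R]_d | forall i, A i (v ord0 i)] =
  (\prod_(i < d) lebesgue_measure (A i))%E.
Proof.
elim: d A => [|n IH] A mA.
  rewrite big_ord0 /= diracE mem_set// => -[].
  by [].
have mB : measurable [set v : 'rV[R]_n | forall i, A (lift ord0 i) (v ord0 i)].
  rewrite (_ : mkset _ = \bigcap_(i in [set: 'I_n])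
    ((fun v : 'rV[R]_n => v ord0 i) @^-1` A (lift ord0 i))).
    apply: fin_bigcap_measurable => // i _.
    by rewrite -[X in measurable X]setTI; exact: measurable_coord.
  by apply/seteqP; split => [v Av i _|v Av i]; exact: Av.
rewrite big_ord_recl -(IH (fun i => A (lift ord0 i)))//.
transitivity ((@lebesgue_measure R \x lebesgue_rV n)%E (A ord0 `*`
    [set v : 'rV[R]_n | forall i, A (lift ord0 i) (v ord0 i)])); last first.
  exact: (@product_measure1E _ _ (measurableTypeR R) _ R (@lebesgue_measure R)
    (lebesgue_rV n) _ _ (mA ord0) mB).
transitivity (lebesgue_cons (lebesgue_rV n)
  [set v : 'rV[R]_n.+1 | forall i, A i (v ord0 i)]); first by [].
rewrite [LHS]/lebesgue_cons [LHS]/pushforward; congr ((_ \x _)%E _).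
apply/seteqP; split=> [[x v] Axv|[x v] [Ax Av] i].
  split=> [|i]; first by have := Axv ord0; rewrite cons_rV0.
  by have := Axv (lift ord0 i); rewrite cons_rVS.
case: (unliftP ord0 i) => [j ->|->]; first by rewrite /= cons_rVS; exact: Av.
by rewrite /= cons_rV0.
Qed.

End lebesgue_rV.

Section sobolev.
Context {R : realType} {d : nat}.
Implicit Types (f g phi : 'rV[R]_d -> R) (s : seq 'I_d).

Definition partial (i : 'I_d) f : 'rV[R]_d -> R :=
  fun x => 'D_(delta_mx ord0 i) f x.

(* The multi-index of an iterated partial derivative is encoded by the list of
   the coordinates of differentiation; its order is the length of the list. *)
Definition partials s f : 'rV[R]_d -> R := foldr partial f s.

Definition smooth f := forall s,
  continuous (partials s f) /\
  (forall (i : 'I_d) x, derivable (partials s f) x (delta_mx ord0 i)).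

Definition test_function phi :=
  smooth phi /\ compact (closure [set x | phi x != 0]).

Definition weak_derivative s f g := forall phi, test_function phi ->
  (\int[lebesgue_rV d]_x (f x * partials s phi x)%:E =
   \int[lebesgue_rV d]_x ((-1) ^+ size s * (g x * phi x))%:E)%E.

Definition sobolev (m : nat) (q : \bar R) f :=
  f \in Lfun (lebesgue_rV d) q /\
  forall s, (size s <= m)%N ->
    exists2 g, g \in Lfun (lebesgue_rV d) q & weak_derivative s f g.

End sobolev.

Section markov.
Context {R : realType} {dE : measure_display} {E : measurableType dE}.
Implicit Types (T : R.-pker E ~> E) (P mu : probability E R).
Local Open Scope ereal_scope.

Definition invariant T P :=
  forall A : set E, measurable A -> \int[P]_x T x A = P A.

Fixpoint iter_kernel T (n : nat) (x : E) (A : set E) : \bar R :=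
  if n is m.+1 then \int[T x]_y iter_kernel T m y A else \d_x A.

(* Irreducibility, aperiodicity (no [n]-cycle with [n >= 2]) and Harris
   recurrence as in Meyn & Tweedie, Markov Chains and Stochastic Stability.
   For a [P]-irreducible kernel with invariant distribution [P], the maximal
   irreducibility measure is equivalent to [P], so that the accessible sets
   are those with [0 < P A]. *)
Definition irreducible T P :=
  forall (x : E) (A : set E), measurable A -> 0 < P A ->
    exists n : nat, 0 < iter_kernel T n.+1 x A.

Definition aperiodic T P :=
  forall (n : nat) (D : 'I_n -> set E), (1 < n)%N ->
    (forall i, measurable (D i)) -> trivIset setT D ->
    (forall i x, D i x -> T x (D (ordS i)) = 1) ->
    P (~` \bigcup_i D i) != 0.

Definition history d (Omega : measurableType d) (Z : nat -> Omega -> E)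
    (n : nat) : set (set Omega) :=
  <<s [set F | exists k (A : set E),
         [/\ (k <= n)%N, measurable A & F = Z k @^-1` A]] >>.

(* The time index starts at 0.  The second clause states that [T (Z n) A] is a
   version of the conditional probability of [Z n.+1 \in A] given the history
   up to time [n]. *)
Definition markov_chain d (Omega : measurableType d) (Q : probability Omega R)
    (Z : nat -> {RV Q >-> E}) mu T :=
  (forall A : set E, measurable A -> distribution Q (Z 0%N) A = mu A) /\
  (forall n (F : set Omega) (A : set E),
     history (fun k => Z k : Omega -> E) n F -> measurable A ->
     Q (F `&` Z n.+1 @^-1` A) = \int[Q]_(w in F) T (Z n w) A).

(* The law of the chain started at [x] is rendered by quantifying over all
   realisations [X] of that chain. *)
Definition harris_recurrent T P :=
  forall A : set E, measurable A -> 0 < P A -> forall x : E, A x ->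
  forall d (Omega : measurableType d) (Q : probability Omega R)
    (X : nat -> {RV Q >-> E}),
    markov_chain X (\d_x : probability E R) T ->
    Q (lim_sup_set (fun n => X n @^-1` A)) = 1.

Definition small_set_condition T P (J : set E) (beta : R)
    (nu : probability E R) :=
  [/\ measurable J, 0 < P J, (0 < beta)%R &
      forall x (A : set E), J x -> measurable A -> beta%:E * nu A <= T x A].

Definition drift_condition T mu1 (J : set E) (V : E -> R) (lambda b : R) :=
  [/\ measurable_fun setT V, (forall x, (1 <= V x)%R),
      (0 < lambda < 1)%R /\ (0 < b)%R,
      (forall x, \int[T x]_y (V y)%:E <=
                 (lambda * V x * \1_(~` J) x + b * \1_J x)%:E) &
      'E_mu1[V] <= (b / (1 - lambda))%:E].

End markov.

Section kde.
Context {R : realType} {d : nat}.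
Implicit Types (K V p : 'rV[R]_d -> R) (h : R).

Definition scaled_kernel K h (x y : 'rV[R]_d) : R :=
  (h ^+ d)^-1 * K (h^-1 *: (x - y)).

Definition kernel_condition K :=
  [/\ forall u, 0 <= K u,
      K \in Lfun (lebesgue_rV d) 1 /\ K \in Lfun (lebesgue_rV d) 2%:E,
      (\int[lebesgue_rV d]_u (K u)%:E = 1)%E,
      (forall i : 'I_d, (\int[lebesgue_rV d]_u (u ord0 i * K u)%:E = 0)%E) &
      (\int[lebesgue_rV d]_u
         ((\sum_(i < d) u ord0 i ^+ 2) * `|K u|)%:E < +oo)%E].

Definition bandwidth_condition (hN : nat -> R) :=
  [/\ (forall N, (0 < N)%N -> 0 < hN N),
      hN N @[N --> \oo] --> (0 : R) &
      N%:R * hN N ^+ d @[N --> \oo] --> +oo].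

Definition density_condition p :=
  sobolev 2 1%E p /\ sobolev 2 2%:E p.

Definition has_density (P : probability 'rV[R]_d R) p :=
  measurable_fun setT p /\
  forall A, measurable A -> P A = (\int[lebesgue_rV d]_(x in A) (p x)%:E)%E.

(* The supremum over [y] is Borel up to a Lebesgue-null set, and the integral
   of a nonnegative function is defined by approximation from below, so that no
   measurability hypothesis is needed. *)
Definition kernel_moment_bound K V (r : nat) (B : R) :=
  0 < B /\ forall h, 0 < h <= 1 ->
    (\int[lebesgue_rV d]_x
        ereal_sup [set (`|scaled_kernel K h x y| ^+ r *
                        V y `^ (- (r%:R / 2)))%:E | y in setT]
     <= (B / h ^+ (r * d))%:E)%E.

Definition kde K h (N : nat) (Z : nat -> 'rV[R]_d) (x : 'rV[R]_d) : R :=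
  N%:R^-1 * \sum_(k < N) scaled_kernel K h x (Z k).

(* For an even kernel the order of the arguments of [K_h] is irrelevant; in
   general the sample point has to be the second one for [kde] to estimate the
   integral of [K_h x] against the stationary distribution. *)
Lemma kde_even K h N (Z : nat -> 'rV[R]_d) x : (forall u, K (- u) = K u) ->
  kde K h N Z x = N%:R^-1 * \sum_(k < N) scaled_kernel K h (Z k) x.
Proof.
move=> Keven; congr (_ * _); apply: eq_bigr => k _; congr (_ * _).
by rewrite -Keven -scalerN opprB.
Qed.

(* Finite at every [x] when [K] and the density of [P] are square-integrable. *)
Definition mean_kernel (P : probability 'rV[R]_d R) K h (x : 'rV[R]_d) : R :=
  fine 'E_P[scaled_kernel K h x].

Definition lnorm (q : R) (f : 'rV[R]_d -> R) : R :=
  fine 'N[lebesgue_rV d]_q%:E [EFin \o f].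

End kde.

Arguments bandwidth_condition {R} d hN.

(* Main.v *)
From HB Require Import structures.
From mathcomp Require Import all_boot all_order all_algebra.
From mathcomp Require Import all_classical all_reals all_analysis.
From mathcomp Require Import measurable_realfun.
From mathcomp Require Import ring lra.
Require Import Defs.

Set Implicit Arguments.
Unset Strict Implicit.
Unset Printing Implicit Defensive.
Import Order.TTheory GRing.Theory Num.Theory.
Import numFieldNormedType.Exports.
Local Open Scope classical_set_scope.
Local Open Scope ring_scope.

(** Write S for the square root of the drift function V, and T f (x) for the
    integral of f against T x.  Everything rests on one fact about the chain:
    there is a constant D such that, whenever |g| <= c S, the empirical mean of
    g over N steps has mean square distance at most c^2 D / N from the
    stationary mean of g ([markov_mean_square_error]).  For a fixed x,
    the function g = K_h(x, .) satisfies this with c the supremum of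
    |K_h(x, .)| V^(-1/2), and also with c^2 the supremum of
    |K_h(x, .)|^2 V^(-1); these are the integrands of the kernel moment
    conditions of orders 1 and 2.  Integrating c sqrt (D / N) and c^2 D / N over x
    ([kde_integrated_errors]) therefore gives the terms with B_1 and B_2, with
    alpha_0 = sqrt D; the other terms on the right are nonnegative.

    The mean square bound comes from Poisson's equation u = g + T u for a
    centred g.  The increments u(Z_(n+1)) - T u (Z_n) are orthogonal to every
    function of a state up to time n ([markov_product]), and they are the increments
    of the sum of g(Z_k) over k < n, plus u(Z_n).  The second moment of the latter
    hence grows linearly in n, because E V(Z_n) <= b / (1 - lambda)
    ([drift_moment]) and |u| <= C S ([poisson_partial_sum_sqr]).

    Poisson's equation is solved by splitting off the regenerations.  By the
    small set condition, R f = T f - beta 1_J nu(f) is a positive operator.  By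
    Jensen's inequality T S <= sqrt lambda S off J and T S <= sqrt b on J.  Adding
    the constant sqrt b / beta to S gives a weight W comparable to S with
    R W <= rho W for some rho < 1: off J the drift of S contracts, and on J the
    mass beta lost by R compensates for sqrt b.  So u = g + R g + R^2 g + ...
    converges geometrically and u = g + R u ([residual_poisson]).  Integrating
    this identity against the invariant distribution P leaves
    beta P(J) nu(u) = 0, whence R u = T u ([poisson_equation]). *)

(** * Integration of nonnegative functions *)

Section nonneg_induction.
Local Open Scope ereal_scope.
Context d (E : measurableType d) (R : realType).
Import HBNNSimple.

(** The standard machine: a nonnegative measurable function is an increasing
    limit of nonnegative combinations of indicators. *)
Lemma ge0_measurable_ind (Pr : (E -> \bar R) -> Prop) :
  (forall A, measurable A -> Pr (fun x => (\1_A x)%:E)) ->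
  (forall (k : R) (f : E -> \bar R), (0 <= k)%R ->
     measurable_fun setT f -> (forall x, 0 <= f x) ->
     Pr f -> Pr (fun x => k%:E * f x)) ->
  (forall f g : E -> \bar R, measurable_fun setT f -> (forall x, 0 <= f x) ->
     measurable_fun setT g -> (forall x, 0 <= g x) ->
     Pr f -> Pr g -> Pr (fun x => f x + g x)) ->
  (forall f : nat -> E -> \bar R, (forall n, measurable_fun setT (f n)) ->
     (forall n x, 0 <= f n x) ->
     (forall x, nondecreasing_seq (f ^~ x)) ->
     (forall n, Pr (f n)) -> Pr (fun x => limn (f ^~ x))) ->
  forall f : E -> \bar R, measurable_fun setT f -> (forall x, 0 <= f x) -> Pr f.
Proof.
move=> PI PZ PD PL f mf f0.
pose f_ := nnsfun_approx measurableT mf.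
rewrite (_ : f = fun x => limn (fun n => (f_ n x)%:E)); last first.
  apply/funext => x; apply/esym/cvg_lim => //.
  exact: cvg_nnsfun_approx.
apply: (PL (fun n x => (f_ n x)%:E)).
- by move=> n; exact/measurable_EFinP/measurable_funP.
- by move=> n x; rewrite lee_fin.
- by move=> x m n mn; rewrite lee_fin; exact/lefP/nd_nnsfun_approx.
move=> n; move: (f_ n) => {mf f0 f_ n}g.
(* A simple function is the sum, over the finitely many values it takes, of
   the value times the indicator of its level set; induct on that list. *)
pose s : seq R := finmap.enum_fset (fset_set (range g)).
pose F (y : R) : set E := g @^-1` [set y].
have mF y : measurable (F y) by exact: measurable_sfunP.
pose h (s : seq R) x : \bar R := \sum_(y <- s) (y%:E * (\1_(F y) x)%:E).
rewrite (_ : (fun x => _) = h s); last first.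
  by apply/funext => x; rewrite [g x]fimfunE fsbig_finite//= -sumEFin.
suff : [/\ Pr (h s), measurable_fun setT (h s) & forall x, 0 <= h s x] by case.
have : forall y, y \in s -> (0 <= y)%R.
  by move=> y; rewrite in_fset_set// inE => -[x _ <-].
clearbody s; elim: s => [|y s ih] sg.
  have h0 : h [::] = fun x => (\1_(@set0 E) x)%:E.
    by apply/funext => x; rewrite /h big_nil indic0.
  rewrite h0; split; [exact: PI| |by move=> x; rewrite lee_fin].
  by apply/measurable_EFinP; exact: measurable_indic.
have [|ihP ihm ih0] := ih; first by move=> z zs; apply: sg; rewrite in_cons zs orbT.
have y0 : (0 <= y)%R by apply: sg; rewrite mem_head.
have m1 : measurable_fun setT (fun x => (\1_(F y) x)%:E : \bar R).
  by apply/measurable_EFinP; exact: measurable_indic.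
have my : measurable_fun [set: E] (fun x => y%:E * (\1_(F y) x)%:E).
  exact: measurable_funeM.
have hy0 x : 0 <= y%:E * (\1_(F y) x)%:E by rewrite mule_ge0 ?lee_fin.
have -> : h (y :: s) = fun x => y%:E * (\1_(F y) x)%:E + h s x.
  by apply/funext => x; rewrite /h big_cons.
split; last 2 first.
- exact: emeasurable_funD.
- by move=> x; rewrite adde_ge0.

apply: PD => //; apply: PZ => //; exact: PI.
Qed.

End nonneg_induction.

Section moments.
Local Open Scope ereal_scope.
Context d (E : measurableType d) (R : realType).
Import HBNNSimple.

(** For nonnegative functions the integral is a supremum over simple functions
    below, which can be rescaled; so the comparison holds for integrands that are
    not known to be measurable, such as a supremum over an uncountable set. *)
Lemma ge0_le_integralZl (mu : {measure set E -> \bar R}) (c : R) (f g : E -> \bar R) :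
  (0 <= c)%R -> (forall x, 0 <= f x) -> (forall x, 0 <= g x) ->
  (forall x, f x <= c%:E * g x) ->
  \int[mu]_x f x <= c%:E * \int[mu]_x g x.
Proof.
move=> c0 f0 g0 fg; have [cE|c_neq0] := eqVneq c 0%R.
  rewrite {1}cE.
  rewrite mul0e integral0_eq// => x _; apply/eqP; rewrite eq_le f0 andbT.
  by rewrite (le_trans (fg x))// cE mul0e.
have cp : (0 < c)%R by rewrite lt_neqAle eq_sym c_neq0.
rewrite !ge0_integralTE//; apply: ge_ereal_sup => _ [h hf <-].
have ci0 : (0 <= c^-1)%R by rewrite invr_ge0.
have -> : sintegral mu h = c%:E * sintegral mu (scale_nnsfun h ci0).
  rewrite (sintegralrM mu c^-1 h) muleA -EFinM mulfV// mul1e//.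
rewrite lee_pmul2l//; apply: ereal_sup_ubound; exists (scale_nnsfun h ci0) => // x.
have -> : (scale_nnsfun h ci0 x)%:E = (c^-1)%:E * (h x)%:E by [].
rewrite -(@lee_pmul2l _ c%:E)// muleA -(EFinM c) mulfV// mul1e.
exact: le_trans (hf x) (fg x).
Qed.

Lemma integral_cst_mass1 (P : {measure set E -> \bar R}) (c : R) : P setT = 1 ->
  \int[P]_x c%:E = c%:E.
Proof.
by move=> P1; rewrite integral_cst// P1 mule1.
Qed.

Lemma integrable_cst_mass1 (P : {measure set E -> \bar R}) (c : R) : P setT = 1 ->
  P.-integrable setT (fun=> c%:E).
Proof.
move=> P1; apply/integrableP; split; first exact: measurable_cst.
by rewrite (integral_cst_mass1 `|c|)// ltry.
Qed.

Lemma Rintegral_cst_mass1 (P : {measure set E -> \bar R}) (c : R) : P setT = 1 ->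
  (\int[P]_x c)%R = c.
Proof. by move=> P1; rewrite /Rintegral (integral_cst_mass1 c). Qed.

(** Jensen's inequality, from |t| <= t^2 / (2 s) + s / 2 with s slightly above
    [a], which is optimal at s = |t| and avoids dividing by [a] when [a] is 0. *)
Lemma expectation_le_sqrt (P : {measure set E -> \bar R}) (f : E -> R) (a : R) :
  P setT = 1 -> measurable_fun setT f -> (0 <= a)%R ->
  \int[P]_x (f x ^+ 2)%:E <= (a ^+ 2)%:E -> \int[P]_x `|f x|%:E <= a%:E.
Proof.
move=> P1 mf a0 fa; apply/lee_addgt0Pr => e e0.
have ae : (0 < a + e)%R by rewrite ltr_wpDl.
have mf2 : measurable_fun setT (fun x => (f x ^+ 2)%:E : \bar R).
  by apply/measurable_EFinP; exact: measurable_funX.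
have h x : `|f x|%:E <= ((2 * (a + e))^-1)%:E * (f x ^+ 2)%:E + ((a + e) / 2)%:E.
  rewrite -EFinM -EFinD lee_fin -real_normK ?num_real//.
  rewrite -subr_ge0 (_ : _ - _ = (`|f x| - (a + e)) ^+ 2 / (2 * (a + e)))%R.
    by rewrite divr_ge0 ?sqr_ge0// mulr_ge0// ltW.
  by field; rewrite gt_eqF.
have : \int[P]_x `|f x|%:E <=
    ((2 * (a + e))^-1)%:E * (a ^+ 2)%:E + ((a + e) / 2)%:E.
  apply: (@le_trans _ _ (\int[P]_x
      (((2 * (a + e))^-1)%:E * (f x ^+ 2)%:E + ((a + e) / 2)%:E))).
    apply: ge0_le_integral => //.
    - by apply/measurable_EFinP; exact: measurableT_comp.
    - by apply: emeasurable_funD => //; exact: measurable_funeM.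
  have k0 : (0 <= (2 * (a + e))^-1)%R by rewrite invr_ge0 mulr_ge0// ltW.
  rewrite ge0_integralD//; first last.
  - by move=> x _; rewrite lee_fin divr_ge0// ltW.
  - exact: measurable_funeM.
  - by move=> x _; rewrite mule_ge0 ?lee_fin// sqr_ge0.
  rewrite ge0_integralZl_EFin//; last by move=> x _; rewrite lee_fin sqr_ge0.
  rewrite integral_cst_mass1// leeD2r//.
  by rewrite lee_wpmul2l ?lee_fin.
move=> /le_trans; apply; rewrite -EFinM -!EFinD lee_fin.
rewrite -subr_ge0 (_ : _ - _ = ((a + e) ^+ 2 - a ^+ 2) / (2 * (a + e)))%R.
  apply: divr_ge0; last by rewrite mulr_ge0// ltW.
  rewrite subr_ge0 ler_sqr ?nnegrE// ?(ltW ae)//.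
  by rewrite lerDl ltW.
by field; rewrite gt_eqF.
Qed.

End moments.

(** * Integration along a transition kernel *)

Section markov_expectation.
Local Open Scope ereal_scope.
Context dO dE (Omega : measurableType dO) (E : measurableType dE) (R : realType).

Lemma ge0_measurable_kernel_integral (T : R.-pker E ~> E) (f : E -> \bar R) :
  measurable_fun setT f -> (forall x, 0 <= f x) ->
  measurable_fun setT (fun x => \int[T x]_y f y).
Proof.
by move=> mf f0; apply: measurable_fun_integral_kernel => // U mU; exact: measurable_kernel.
Qed.

(** Extends a disintegration identity from indicators to nonnegative functions.
    It serves both for one step of the chain and for invariance of a measure. *)
Lemma ge0_integral_comp_kernel (T : R.-pker E ~> E) (Q : probability Omega R)
    (X Y : Omega -> E) (F : set Omega) :
    measurable_fun setT X -> measurable_fun setT Y -> measurable F ->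
    (forall A, measurable A -> Q (F `&` Y @^-1` A) = \int[Q]_(w in F) T (X w) A) ->
  forall f : E -> \bar R, measurable_fun setT f -> (forall x, 0 <= f x) ->
  \int[Q]_(w in F) f (Y w) = \int[Q]_(w in F) (\int[T (X w)]_y f y).
Proof.
move=> mX mY mF TQ.
have mT f : measurable_fun setT f -> (forall x, 0 <= f x) ->
    measurable_fun F (fun w => \int[T (X w)]_y f y).
  move=> mf f0; apply: measurable_funTS.
  exact: (measurableT_comp (ge0_measurable_kernel_integral T mf f0) mX).
have mfY (f : E -> \bar R) : measurable_fun setT f -> measurable_fun F (f \o Y).
  by move=> mf; apply: measurable_funTS; exact: measurableT_comp.
have T0 (f : E -> \bar R) w : (forall x, 0 <= f x) -> 0 <= \int[T (X w)]_y f y.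
  by move=> f0; exact: integral_ge0.
apply: ge0_measurable_ind.
- move=> A mA.
  rewrite (_ : (fun w => _) = fun w => (\1_(Y @^-1` A) w)%:E)//.
  have mYA : measurable (Y @^-1` A) by rewrite -[X in measurable X]setTI; exact: mY.
  rewrite integral_indic//.
  rewrite setIC; transitivity (\int[Q]_(w in F) T (X w) A); first exact: TQ.
  apply: eq_integral => w _.
  by rewrite integral_indic// setIT.
- move=> k f k0 mf f0 ih.
  rewrite ge0_integralZl_EFin//; last exact: mfY.
  rewrite ih -ge0_integralZl_EFin//; last 2 first.
    by move=> w _; exact: T0.
    exact: mT.
  by apply: eq_integral => w _; rewrite ge0_integralZl_EFin.
- move=> f g mf f0 mg g0 ihf ihg.
  rewrite ge0_integralD//; [|exact: mfY|exact: mfY].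
  rewrite ihf ihg -ge0_integralD//; [|by move=> w _; exact: T0|exact: mT
    |by move=> w _; exact: T0|exact: mT].
  by apply: eq_integral => w _; rewrite ge0_integralD.
- move=> f mf f0 ndf ih.
  rewrite monotone_convergence//; last by move=> n; exact: (mfY (f n)).
  under eq_fun do rewrite ih.
  rewrite -monotone_convergence//; first last.
  + move=> w _ m n mn; apply: ge0_le_integral => // x _; exact: ndf.
  + by move=> n w _; exact: T0.
  + by move=> n; exact: mT.
  apply: eq_integral => w _; rewrite monotone_convergence// => x _; exact: ndf.
Qed.

(** Two weights [G] and [H] with the same integrals over the events generated by
    [X] have the same conditional expectation given [X], and can be exchanged in
    front of any function of [X]. *)
Lemma ge0_integralM_comp (Q : probability Omega R) (X : Omega -> E)
    (G H : Omega -> R) :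
    measurable_fun setT X ->
    measurable_fun setT G -> (forall w, 0 <= G w)%R ->
    measurable_fun setT H -> (forall w, 0 <= H w)%R ->
    (forall B, measurable B ->
       \int[Q]_(w in X @^-1` B) (G w)%:E = \int[Q]_(w in X @^-1` B) (H w)%:E) ->
  forall f : E -> \bar R, measurable_fun setT f -> (forall x, 0 <= f x) ->
  \int[Q]_w (f (X w) * (G w)%:E) = \int[Q]_w (f (X w) * (H w)%:E).
Proof.
move=> mX mG G0 mH H0 GH.
have mfX (f : E -> \bar R) : measurable_fun setT f -> measurable_fun setT (fun w => f (X w)).
  by move=> mf; exact: measurableT_comp.
have mM (g : Omega -> R) : measurable_fun setT g -> forall f : E -> \bar R, measurable_fun setT f ->
    measurable_fun setT (fun w => f (X w) * (g w)%:E).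
  by move=> mg f mf; apply: emeasurable_funM; [exact: mfX|exact/measurable_EFinP].
apply: ge0_measurable_ind.
- move=> A mA; have := GH A mA.
  have step (g : Omega -> R) :
      \int[Q]_w ((\1_A (X w))%:E * (g w)%:E) = \int[Q]_(w in X @^-1` A) (g w)%:E.
    rewrite [RHS]integral_mkcond; apply: eq_integral => w _.
    rewrite /patch indicE /=; case: ifPn => wA.
      by rewrite (_ : _ \in A) ?mul1e//; move: wA; rewrite !inE.
    rewrite (_ : _ \in A = false) ?mul0e//; apply/negbTE; move: wA.
    by apply: contra; rewrite !inE.
  by rewrite !step.
- move=> k f k0 mf f0 ih.
  have step (g : Omega -> R) : measurable_fun setT g -> (forall w, 0 <= g w)%R ->
      \int[Q]_w (k%:E * f (X w) * (g w)%:E) = k%:E * \int[Q]_w (f (X w) * (g w)%:E).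
    move=> mg g0; rewrite -ge0_integralZl_EFin//.
    - by apply: eq_integral => w _; rewrite muleA.
    - by move=> w _; rewrite mule_ge0 ?lee_fin.
    - exact: mM.
  by rewrite !step// ih.
- move=> f g mf f0 mg g0 ihf ihg.
  have step (u : Omega -> R) : measurable_fun setT u -> (forall w, 0 <= u w)%R ->
      \int[Q]_w ((f (X w) + g (X w)) * (u w)%:E) =
      \int[Q]_w (f (X w) * (u w)%:E) + \int[Q]_w (g (X w) * (u w)%:E).
    move=> mu u0; rewrite -ge0_integralD//.
    - by apply: eq_integral => w _; rewrite ge0_muleDl.
    - by move=> w _; rewrite mule_ge0 ?lee_fin.
    - exact: mM.
    - by move=> w _; rewrite mule_ge0 ?lee_fin.
    - exact: mM.
  by rewrite !step// ihf ihg.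
- move=> f mf f0 ndf ih.
  have step (u : Omega -> R) : measurable_fun setT u -> (forall w, 0 <= u w)%R ->
      \int[Q]_w (limn (f ^~ (X w)) * (u w)%:E) =
      limn (fun n => \int[Q]_w (f n (X w) * (u w)%:E)).
    move=> mu u0; rewrite -monotone_convergence//.
    - apply: eq_integral => w _; rewrite -limeMr//.
      by apply: ereal_nondecreasing_is_cvgn; exact: ndf.
    - move=> n; exact: mM.
    - by move=> n w _; rewrite mule_ge0 ?lee_fin.
    - by move=> w _ m n mn; rewrite lee_wpmul2r ?lee_fin//; exact: ndf.
  rewrite !step//; congr (limn _); apply/funext => n; exact: ih.
Qed.

End markov_expectation.

Section invariant_integral.
Local Open Scope ereal_scope.
Context dE (E : measurableType dE) (R : realType).

Lemma ge0_invariant_integral (T : R.-pker E ~> E) (P : probability E R)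
    (g : E -> \bar R) :
  invariant T P -> measurable_fun setT g -> (forall x, 0 <= g x) ->
  \int[P]_x g x = \int[P]_x \int[T x]_y g y.
Proof.
move=> Tinv mg g0.
apply: (@ge0_integral_comp_kernel _ _ E E R T P id id setT) => // A mA.
by rewrite setTI Tinv.
Qed.

End invariant_integral.

(** * Sequences with geometrically small increments *)

Section geometric_increments.
Context (R : realType) (v : nat -> R) (C rho : R).
Hypotheses (rho01 : 0 <= rho < 1)
  (dv : forall n, `|v n.+1 - v n| <= C * rho ^+ n).

Lemma geometric_increments_cvg : cvgn v.
Proof.
have [r0 r1] := andP rho01.
have -> : v = fun n => series (telescope v) n + v 0%N.
  by apply/funext => n; rewrite telescopeK /= subrK.
apply: is_cvgD; last exact: is_cvg_cst.
apply: normed_cvg; apply: (@series_le_cvg _ _ (geometric C rho)) => //.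
- by move=> n /=; exact: normr_ge0.
- by move=> n /=; exact: le_trans (normr_ge0 _) (dv n).
- by apply: is_cvg_geometric_series; rewrite ger0_norm.
Qed.

Lemma geometric_increments_lim n : `|limn v - v n| <= C * rho ^+ n / (1 - rho).
Proof.
have [r0 r1] := andP rho01.
have r10 : 0 < 1 - rho by rewrite subr_gt0.
have C0 : 0 <= C.
  by have := dv 0%N; rewrite expr0 mulr1; apply: le_trans; exact: normr_ge0.
have dvk k : `|v (n + k)%N - v n| <= C * rho ^+ n * (1 - rho ^+ k) / (1 - rho).
  elim: k => [|k ih]; first by rewrite addn0 subrr normr0 expr0 subrr mulr0 mul0r.
  rewrite addnS (_ : _ - _ = (v (n + k).+1 - v (n + k)%N) + (v (n + k)%N - v n)).
    rewrite (le_trans (ler_normD _ _))// (le_trans (lerD (dv _) ih))//.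
    rewrite le_eqVlt; apply/orP; left; apply/eqP.
    by rewrite exprD exprS; field; rewrite gt_eqF.
  ring.
have cv : cvgn (fun m => `|v m - v n|).
  by apply: is_cvg_norm; apply: is_cvgB; [exact: geometric_increments_cvg|exact: is_cvg_cst].
have -> : `|limn v - v n| = limn (fun m => `|v m - v n|).
  apply/esym/cvg_lim => //; apply: cvg_norm; apply: cvgB; last exact: cvg_cst.
  exact: geometric_increments_cvg.
apply: limr_le => //; exists n => // m /= nm.
rewrite -(subnKC nm) (le_trans (dvk _))// ler_wpM2r ?invr_ge0 ?(ltW r10)//.
rewrite ler_piMr ?mulr_ge0 ?exprn_ge0//.
by rewrite lerBlDr lerDl exprn_ge0.
Qed.

End geometric_increments.

(** * Poisson's equation for a kernel with a small set *)

Section residual_kernel.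
Context dE (E : measurableType dE) (R : realType).
Context (T : R.-pker E ~> E) (nu : probability E R) (J : set E) (beta : R).
Context (W : E -> R).

(** The ball of radius [c] in the sup norm weighted by [W]. *)
Definition dominated (c : R) (f : E -> R) :=
  measurable_fun setT f /\ forall x, `|f x| <= c * W x.

(** The kernel left when, on [J], the component [beta * nu] of the transition is
    removed, as an operator on functions; regenerations of the split chain happen
    according to the removed part. *)
Definition residual (f : E -> R) (x : E) : R :=
  \int[T x]_y f y - beta * \1_J x * \int[nu]_y f y.

Hypotheses (mJ : measurable J) (beta_gt0 : 0 < beta)
  (minor : forall x (A : set E), J x -> measurable A -> (beta%:E * nu A <= T x A)%E).
Hypotheses (mW : measurable_fun setT W) (W_gt0 : forall x, 0 < W x)
  (TW : forall x, (T x).-integrable setT (EFin \o W))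
  (nuW : nu.-integrable setT (EFin \o W)).

Lemma dominated_integrable (mu : {measure set E -> \bar R}) c f :
  mu.-integrable setT (EFin \o W) -> dominated c f ->
  mu.-integrable setT (EFin \o f).
Proof.
move=> iW [mf fW].
apply: (@le_integrable _ _ _ mu setT measurableT _ (fun x => c%:E * (EFin \o W) x)%E).
- exact/measurable_EFinP.
- move=> x _ /=; rewrite lee_fin (le_trans (fW x))// ler_norm//.
- exact: integrableZl.
Qed.

Lemma dominated_weight : dominated 1 W.
Proof. by split=> // x; rewrite mul1r gtr0_norm. Qed.

Lemma dominated0 : dominated 0 (cst 0).
Proof. by split=> [|x]; [exact: measurable_cst|rewrite normr0 mul0r]. Qed.

Lemma dominatedZ k c f : dominated c f -> dominated (`|k| * c) (fun x => k * f x).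
Proof.
move=> [mf fW]; split=> [|x]; first exact: measurable_funM.
by rewrite normrM -mulrA ler_wpM2l.
Qed.

Lemma dominatedD c c' f g : dominated c f -> dominated c' g ->
  dominated (c + c') (fun x => f x + g x).
Proof.
move=> [mf fW] [mg gW]; split=> [|x]; first exact: measurable_funD.
by rewrite (le_trans (ler_normD _ _))// mulrDl lerD.
Qed.

Lemma dominatedB c c' f g : dominated c f -> dominated c' g ->
  dominated (c + c') (fun x => f x - g x).
Proof.
move=> [mf fW] [mg gW]; split=> [|x]; first exact: measurable_funB.
by rewrite (le_trans (ler_normB _ _))// mulrDl lerD.
Qed.

Let iT c f (h : dominated c f) x := dominated_integrable (TW x) h.
Let inu c f (h : dominated c f) := dominated_integrable nuW h.

Lemma residualD c c' f g x : dominated c f -> dominated c' g ->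
  residual (fun x => f x + g x) x = residual f x + residual g x.
Proof.
move=> hf hg; rewrite /residual !RintegralD//.
all: try exact: (iT hf); try exact: (iT hg).
all: try exact: (inu hf); try exact: (inu hg).
ring.
Qed.

Lemma residualB c c' f g x : dominated c f -> dominated c' g ->
  residual (fun x => f x - g x) x = residual f x - residual g x.
Proof.
move=> hf hg; rewrite /residual !RintegralB//.
all: try exact: (iT hf); try exact: (iT hg).
all: try exact: (inu hf); try exact: (inu hg).
ring.
Qed.

Lemma residualZ k c f x : dominated c f ->
  residual (fun x => k * f x) x = k * residual f x.
Proof.
move=> hf; rewrite /residual !RintegralZl//.
all: try exact: (iT hf); try exact: (inu hf).
ring.
Qed.

(** This is where the minorisation of [T] by [beta * nu] on [J] enters. *)
Lemma residual_ge0 c f x : dominated c f -> (forall y, 0 <= f y) ->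
  0 <= residual f x.
Proof.
move=> hf f0; rewrite /residual subr_ge0 indicE.
have [xJ|xJ] := boolP (x \in J); last first.
  by rewrite mulr0 mul0r; exact: Rintegral_ge0.
rewrite mulr1 -lee_fin /Rintegral EFinM !fineK//; first last.
- by apply: integrable_fin_num => //; exact: (inu hf).
- by apply: integrable_fin_num => //; exact: (iT hf).
have mf : measurable_fun setT (fun y => (f y)%:E : \bar R).
  by apply/measurable_EFinP; case: hf.
pose b := NngNum (ltW beta_gt0).
rewrite -[beta]/(b%:num) -ge0_integral_mscale//; last by move=> y _; rewrite lee_fin.
apply: ge0_le_measure_integral => // A mA.
by apply: minor => //; rewrite inE in xJ.
Qed.

(** Adding [c * W] makes [f] nonnegative, so that measurability of integrals of
    nonnegative functions against a kernel applies. *)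
Lemma measurable_Rintegral_kernel c f : dominated c f ->
  measurable_fun setT (fun x => \int[T x]_y f y).
Proof.
move=> hf.
have hcW := dominatedZ c dominated_weight.
have hfW := dominatedD hf hcW.
have fW0 y : 0 <= f y + c * W y.
  have [_ /(_ y)] := hf; rewrite ler_norml => /andP[+ _].
  by rewrite -subr_ge0 opprK.
have -> : (fun x => \int[T x]_y f y) =
    fun x => \int[T x]_y (f y + c * W y) - \int[T x]_y (c * W y).
  apply/funext => x; rewrite (@RintegralD _ _ _ _ _ f)//; last 2 first.
  - exact: (iT hf).
  - exact: (iT hcW).
  by rewrite addrK.
have key (g : E -> R) : measurable_fun setT g -> (forall y, 0 <= g y) ->
    measurable_fun setT (fun x => \int[T x]_y g y).
  move=> mg g0; apply: measurableT_comp; first exact: fine_measurable.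
  apply: ge0_measurable_kernel_integral; first exact/measurable_EFinP.
  by move=> y; rewrite lee_fin.
apply: measurable_funB; first by apply: key => //; case: hfW.
have -> : (fun x => \int[T x]_y (c * W y)) = fun x => c * \int[T x]_y W y.
  by apply/funext => x; rewrite RintegralZl//; exact: TW.
by apply: measurable_funM => //; apply: key => // y; exact: ltW.
Qed.

Context (rho : R).
Hypotheses (rho01 : 0 <= rho < 1) (drift : forall x, residual W x <= rho * W x).

(** A positive operator that contracts the weight contracts the weighted sup
    norm: apply it to the nonnegative functions [c * W - f] and [c * W + f]. *)
Lemma residual_dominated c f : dominated c f -> dominated (c * rho) (residual f).
Proof.
move=> hf; split.
  apply: measurable_funB; first exact: measurable_Rintegral_kernel hf.
  by apply: measurable_funM => //; apply: measurable_funM => //; exact: measurable_indic.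
move=> x; have hW := dominated_weight.
have c0 : 0 <= c.
  have [_ /(_ x)] := hf => fW.
  by rewrite -(pmulr_lge0 _ (W_gt0 x)) (le_trans _ fW).
have hcW := dominatedZ c hW.
have [_ fW] := hf.
rewrite -mulrA (@le_trans _ _ (c * residual W x))//; last exact: ler_wpM2l.
rewrite ler_norml -(residualZ _ _ hW) -subr_ge0 opprK -(residualD _ hf hcW).
rewrite -(subr_ge0 (residual f x)) -(residualB _ hcW hf).
apply/andP; split.
  apply: (residual_ge0 _ (dominatedD hf hcW)) => y.
  by have := fW y; rewrite ler_norml => /andP[+ _]; rewrite -subr_ge0 opprK.
apply: (residual_ge0 _ (dominatedB hcW hf)) => y.
by have := fW y; rewrite ler_norml => /andP[_ +]; rewrite -subr_ge0.
Qed.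

(** Picard iteration for the contraction [u |-> g + residual u], that is, the
    Neumann series of the residual kernel. *)
Lemma residual_poisson c g : dominated c g ->
  exists2 u, dominated (c / (1 - rho)) u & forall x, u x = g x + residual u x.
Proof.
move=> hg.
pose v n := iter n (fun u x => g x + residual u x) (cst 0).
have vS n : v n.+1 = fun x => g x + residual (v n) x by [].
have [r0 r1] := andP rho01.
have r10 : 0 < 1 - rho by rewrite subr_gt0.
have hv n : exists k, dominated k (v n).
  elim: n => [|n [k ih]]; first by exists 0; exact: dominated0.
  by exists (c + k * rho); rewrite vS; apply: dominatedD => //; exact: residual_dominated.
have dv n : dominated (c * rho ^+ n) (fun x => v n.+1 x - v n x).
  elim: n => [|n ih].
    have [mg gW] := hg; split=> [|x].
      by have [k1 [m1 _]] := hv 1%N; have [k0 [m0 _]] := hv 0%N; exact: measurable_funB.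
    rewrite expr0 mulr1 vS /= subr0.
    have := residualB x dominated0 dominated0.
    rewrite subrr; under [X in residual X]eq_fun do rewrite subrr.
    by move=> ->; rewrite addr0.
  have [k1 h1] := hv n.+1; have [k0 h0] := hv n.
  have -> : (fun x => v n.+2 x - v n.+1 x) = residual (fun x => v n.+1 x - v n x).
    apply/funext => x; rewrite (residualB _ h1 h0) [in LHS]vS [v n.+1 in X in _ - X]vS.
    ring.
  by rewrite exprSr mulrA; exact: residual_dominated.
have dvx x n : `|v n.+1 x - v n x| <= (c * W x) * rho ^+ n.
  by have [_ /(_ x)] := dv n; rewrite mulrAC.
pose u x := limn (v ^~ x).
have cv x : cvgn (v ^~ x).
  by apply: (@geometric_increments_cvg _ _ (c * W x) rho) => // n; exact: dvx.
have uv n : dominated (c * rho ^+ n / (1 - rho)) (fun x => u x - v n x).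
  split.
    apply: measurable_funB; last by have [k []] := hv n.
    apply: (@measurable_fun_cvg _ _ _ _ v) => [m|x _]; last exact: cv.
    by have [k []] := hv m.
  move=> x; rewrite (_ : _ * W x = c * W x * rho ^+ n / (1 - rho)); last by ring.
  by apply: geometric_increments_lim => // m; exact: dvx.
have hu : dominated (c / (1 - rho)) u.
  have [mu uW] := uv 0%N; split=> [|x].
    by rewrite (_ : u = fun x => u x - v 0%N x)//; apply/funext => x; rewrite subr0.
  by have := uW x; rewrite expr0 mulr1 subr0.
exists u => // x.
have [k0 h0] := hv 0%N.
pose q := 2 * c / (1 - rho) * W x.
have bnd n : `|u x - (g x + residual u x)| <= q * rho ^+ n.
  have [k h] := hv n.
  have [_ /(_ x) e1] := uv n.+1.
  have [_ /(_ x)] := residual_dominated (uv n).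
  rewrite (residualB _ hu h) => e2.
  rewrite (_ : u x - _ = (u x - v n.+1 x) - (residual u x - residual (v n) x)).
    rewrite (le_trans (ler_normB _ _))// (le_trans (lerD e1 e2))//.
    rewrite exprSr (_ : _ + _ = q * rho ^+ n * rho); last by rewrite /q; field; rewrite gt_eqF.
    have c0 : 0 <= c.
      by have := dvx x 0%N; rewrite expr0 mulr1 -(pmulr_lge0 _ (W_gt0 x)); apply: le_trans.
    rewrite ler_piMr ?(ltW r1)// mulr_ge0 ?exprn_ge0//.
    by rewrite /q !mulr_ge0// ?invr_ge0 ltW.
  by rewrite vS; ring.
apply/eqP; rewrite -subr_eq0 -normr_le0.
have <- : limn (geometric q rho) = 0.
  by apply/cvg_lim => //; apply: cvg_geometric; rewrite ger0_norm.
apply: limr_ge; last by apply: nearW => n; exact: bnd.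
by apply: cvgP; apply: cvg_geometric; rewrite ger0_norm.
Qed.

Context (P : probability E R).
Hypotheses (Tinv : invariant T P) (PW : P.-integrable setT (EFin \o W))
  (PJ : (0 < P J)%E).

Let ge0_invariant c f : dominated c f -> (forall x, 0 <= f x) ->
  P.-integrable setT (fun x => (\int[T x]_y f y)%:E) /\
  \int[P]_x \int[T x]_y f y = \int[P]_x f x.
Proof.
move=> hf f0.
have ET x : (\int[T x]_y f y)%:E = (\int[T x]_y (f y)%:E)%E.
  by rewrite /Rintegral fineK// integrable_fin_num//; exact: (iT hf).
have mf : measurable_fun setT (fun y => (f y)%:E : \bar R).
  by apply/measurable_EFinP; case: hf.
have eqP : (\int[P]_x (\int[T x]_y f y)%:E = \int[P]_x (f x)%:E)%E.
  under eq_integral do rewrite ET.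
  by rewrite -(ge0_invariant_integral Tinv)// => x; rewrite lee_fin.
split; last by rewrite /Rintegral -eqP.
apply/integrableP; split.
  by apply/measurable_EFinP; exact: measurable_Rintegral_kernel hf.
under eq_integral do rewrite gee0_abs ?lee_fin ?Rintegral_ge0//.
rewrite eqP; have /integrableP[_] := dominated_integrable PW hf.
by under eq_integral do rewrite /= ger0_norm//.
Qed.

(** The integrability over [P] of T f comes from the invariance identity for
    nonnegative functions, of which [f] is a difference. *)
Lemma invariant_Rintegral c f : dominated c f ->
  P.-integrable setT (fun x => (\int[T x]_y f y)%:E) /\
  \int[P]_x \int[T x]_y f y = \int[P]_x f x.
Proof.
move=> hf.
have hcW := dominatedZ c dominated_weight.
have c0 : 0 <= c.
  have [_ /(_ point)] := hf => fW.
  by rewrite -(pmulr_lge0 _ (W_gt0 point)) (le_trans _ fW).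
have hfW := dominatedD hf hcW.
have fW0 y : 0 <= f y + c * W y.
  have [_ /(_ y)] := hf; rewrite ler_norml => /andP[+ _].
  by rewrite -subr_ge0 opprK.
have [i1 e1] := ge0_invariant hfW fW0.
have [i2 e2] := ge0_invariant hcW (fun y => mulr_ge0 c0 (ltW (W_gt0 y))).
have Tf : (fun x => \int[T x]_y f y) =
    fun x => \int[T x]_y (f y + c * W y) - \int[T x]_y (c * W y).
  apply/funext => x; rewrite (@RintegralD _ _ _ _ _ f)//; last 2 first.
  - exact: (iT hf).
  - exact: (iT hcW).
  by rewrite addrK.
have -> : (fun x => (\int[T x]_y f y)%:E) =
    (fun x => (\int[T x]_y (f y + c * W y))%:E - (\int[T x]_y (c * W y))%:E)%E.
  by apply/funext => x; rewrite (congr1 (fun h => h x) Tf) EFinB.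
split; first exact: (integrableB measurableT i1 i2).
rewrite Tf RintegralB// e1 e2 RintegralD//.
- by rewrite addrK.
- exact: dominated_integrable hf.
- exact: dominated_integrable hcW.
Qed.

(** The residual kernel differs from [T] by [beta * \1_J] times the integral of
    [u] against [nu], and integrating [u = g + residual u] against the invariant
    measure shows that this integral is 0. *)
Lemma poisson_equation c g : dominated c g -> \int[P]_x g x = 0 ->
  exists2 u, dominated (c / (1 - rho)) u & forall x, u x = g x + \int[T x]_y u y.
Proof.
move=> hg Pg; have [u hu uE] := residual_poisson hg.
exists u => // x.
suff nu0 : \int[nu]_y u y = 0 by rewrite uE /residual nu0 mulr0 subr0.
have [iTu PTu] := invariant_Rintegral hu.
have iu := dominated_integrable PW hu.
have ig := dominated_integrable PW hg.
pose k := beta * \int[nu]_y u y.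
have TuE : (fun x => \int[T x]_y u y) = fun x => u x - g x + k * \1_J x.
  by apply/funext => z; rewrite [in RHS]uE /residual /k; ring.
have iJ : P.-integrable setT (EFin \o \1_J) by exact: integrable_indic.
move: PTu; rewrite TuE RintegralD//; last 2 first.
- exact: (integrableB measurableT iu ig).
- by apply: (integrableZl measurableT k iJ).
rewrite RintegralB// Pg subr0 RintegralZl// => /eqP.
rewrite -[X in _ == X]addr0 (inj_eq (addrI _)) /Rintegral integral_indic// setIT.
rewrite /k !mulf_eq0 (gt_eqF beta_gt0)/= => /orP[/eqP//|].
by rewrite gt_eqF// fine_gt0// PJ/= ltey_eq fin_num_measure.
Qed.
End residual_kernel.

(** * Consequences of the drift condition *)

Section drift.
Context dE (E : measurableType dE) (R : realType).
Context (T : R.-pker E ~> E) (P : probability E R).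

(** Invariance cannot be applied to [S] before it is known to be integrable.  It
    is applied to the truncation min(S, n) instead, whose image under [T] is at
    most min(rho S + k, n); Fatou's lemma, for the functions
    min(S, n) + k - min(rho S + k, n) >= 0 that tend to (1 - rho) S, then bounds
    (1 - rho) times the integral of [S] by [k]. *)
Lemma invariant_integrable (S : E -> R) (rho k : R) :
  invariant T P -> measurable_fun setT S -> (forall x, 0 <= S x) ->
  0 <= rho < 1 -> 0 <= k ->
  (forall x, \int[T x]_y (S y)%:E <= (rho * S x + k)%:E)%E ->
  P.-integrable setT (EFin \o S).
Proof.
move=> Tinv mS S0 /andP[r0 r1] k0 TS.
have r10 : 0 < 1 - rho by rewrite subr_gt0.
pose L x := rho * S x + k.
have mL : measurable_fun setT L.
  by apply: measurable_funD => //; exact: measurable_funM.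
have L0 x : 0 <= L x by rewrite addr_ge0 ?mulr_ge0.
pose A n x := Num.min (S x) n%:R.
pose B n x := Num.min (L x) n%:R.
have mA n : measurable_fun setT (EFin \o A n).
  by apply/measurable_EFinP; exact: measurable_minr.
have mB n : measurable_fun setT (EFin \o B n).
  by apply/measurable_EFinP; exact: measurable_minr.
have A0 n x : 0 <= A n x by rewrite le_min S0 ler0n.
have B0 n x : 0 <= B n x by rewrite le_min L0 ler0n.
pose h n x := A n x + k - B n x.
have h0 n x : 0 <= h n x.
  rewrite /h subr_ge0 /A /B /L.
  have [Sn|Sn] := leP (S x) n%:R.
    by rewrite ge_min lerD// ler_piMl// ltW.
  by rewrite ge_min lerDl k0 orbT.
have mh n : measurable_fun setT (fun x => (h n x)%:E : \bar R).
  apply/measurable_EFinP; apply: measurable_funB; last exact/measurable_EFinP/mB.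
  by apply: measurable_funD => //; exact/measurable_EFinP/mA.
have AB n : (\int[P]_x (A n x)%:E <= \int[P]_x (B n x)%:E)%E.
  rewrite (ge0_invariant_integral Tinv) //; [|exact: mA|by move=> x /=; rewrite lee_fin].
  apply: ge0_le_integral => //.
  - by move=> x _; apply: integral_ge0 => y _; rewrite lee_fin.
  - by apply: ge0_measurable_kernel_integral; [exact: mA|move=> x; rewrite lee_fin].
  - exact: mB.
  move=> x _; rewrite /B EFin_min le_min; apply/andP; split.
    apply: le_trans (TS x); apply: ge0_le_integral => //.
    - by move=> y _ /=; rewrite lee_fin.
    - exact: mA.
    - exact/measurable_EFinP.
    - by move=> y _ /=; rewrite lee_fin ge_min lexx.
  apply: (@le_trans _ _ (\int[T x]__ n%:R%:E)%E).
    apply: ge0_le_integral => //.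
    - by move=> y _ /=; rewrite lee_fin.
    - exact: mA.
    - by move=> y _ /=; rewrite lee_fin ge_min lexx orbT.
  by rewrite integral_cst_mass1//; exact: prob_kernel.
have Bfin n : (\int[P]_x (B n x)%:E)%E \is a fin_num.
  rewrite ge0_fin_numE; last by apply: integral_ge0 => x _; rewrite lee_fin.
  apply: (@le_lt_trans _ _ (\int[P]__ n%:R%:E)%E).
    apply: ge0_le_integral => //.
    - by move=> y _ /=; rewrite lee_fin.
    - exact: mB.
    - by move=> y _ /=; rewrite lee_fin ge_min lexx orbT.
  rewrite integral_cst_mass1 ?ltry//; exact: probability_setT.
have hk n : (\int[P]_x (h n x)%:E <= k%:E)%E.
  rewrite -(leeD2rE _ _ (Bfin n)) -ge0_integralD//; first last.
  - exact: mB.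
  - by move=> x _ /=; rewrite lee_fin.
  - by move=> x _ /=; rewrite lee_fin.
  rewrite (@eq_integral _ _ _ _ _ (fun x => (A n x)%:E + k%:E)%E); last first.
    by move=> x _; rewrite -!EFinD /h subrK.
  rewrite ge0_integralD//; [|by move=> x _ /=; rewrite lee_fin|exact: mA].
  rewrite integral_cst_mass1; last exact: probability_setT.
  by rewrite addeC leeD2l.
have hlim x : (limn_einf (fun n => (h n x)%:E) = ((1 - rho) * S x)%:E)%E.
  suff hc : (fun n => (h n x)%:E) @ \oo --> ((1 - rho) * S x)%:E.
    rewrite is_cvg_limn_einfE; first exact/cvg_lim.
    by apply: cvgP hc.
  apply: cvg_near_cst.
  near=> n.
  have Sn : S x <= n%:R by near: n; exact: nbhs_infty_ger.
  have Ln : L x <= n%:R by near: n; exact: nbhs_infty_ger.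
  rewrite /h /A /B !min_l// /L; congr EFin; ring.
have : (\int[P]_x ((1 - rho) * S x)%:E <= k%:E)%E.
  under eq_integral do rewrite -hlim.
  apply: le_trans (fatou P measurableT mh _) _.
    by move=> n x _; rewrite lee_fin.
  rewrite limn_einf_lim; apply: lime_le; first exact: is_cvg_einfs.
  apply: nearW => n; apply: le_trans (hk n).
  by apply: ereal_inf_lbound; exists n => /=.
move=> Sk; apply/integrableP; split; first exact/measurable_EFinP.
under eq_integral do rewrite /= ger0_norm//.
have : (\int[P]_x ((1 - rho)%:E * (S x)%:E) < +oo)%E by exact: le_lt_trans Sk (ltry k).
rewrite ge0_integralZl_EFin//; last 3 first.
- by move=> x _; rewrite lee_fin.
- exact/measurable_EFinP.
- exact: ltW.
by rewrite !ltey; apply: contra => /eqP ->; rewrite gt0_muley ?lte_fin.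
Unshelve. all: by end_near. Qed.

End drift.

Section drift_poisson.
Context dE (E : measurableType dE) (R : realType).
Context (T : R.-pker E ~> E) (P mu1 nu : probability E R) (J : set E)
  (beta lambda b : R) (V : E -> R).
Hypotheses (Tinv : invariant T P) (SSC : small_set_condition T P J beta nu)
  (DC : drift_condition T mu1 J V lambda b).

Let S x := Num.sqrt (V x).

Let mV : measurable_fun setT V. Proof. by case: DC. Qed.
Let V_ge1 x : 1 <= V x. Proof. by case: DC. Qed.

Lemma measurable_sqrt_drift : measurable_fun setT S.
Proof.
apply: measurableT_comp => //.
by apply: continuous_measurable_fun; exact: sqrt_continuous.
Qed.

Lemma sqrt_drift_ge1 x : 1 <= S x.
Proof. by rewrite -[leLHS]sqrtr1 ler_sqrt ?(le_trans ler01)//. Qed.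

Let rho := Num.sqrt lambda.
Let k := Num.sqrt b.

(** Poisson's equation has to be solved in the norm weighted by the square root
    of [V], for the square of the solution to be dominated by [V]; Jensen's
    inequality turns the drift condition for [V] into one for the square root. *)
Lemma drift_sqrt x :
  (\int[T x]_y (S y)%:E <= (rho * S x * \1_(~` J) x + k * \1_J x)%:E)%E.
Proof.
have [_ _ [/andP[l0 l1] b0] TV _] := DC.
have V0 y : 0 <= V y by apply: le_trans (V_ge1 y).
rewrite (_ : (fun y => (S y)%:E) = fun y => `|S y|%:E); last first.
  by apply/funext => y; rewrite ger0_norm ?sqrtr_ge0.
apply: expectation_le_sqrt; [exact: prob_kernel|exact: measurable_sqrt_drift| |].
  by rewrite addr_ge0 ?mulr_ge0 ?sqrtr_ge0.
under eq_integral do rewrite sqr_sqrtr//.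
rewrite (le_trans (TV x))// lee_fin !indicE in_setC.
case: (x \in J) => /=; rewrite ?mulr0 ?mulr1 ?add0r ?addr0.
  by rewrite sqr_sqrtr// ltW.
by rewrite exprMn !sqr_sqrtr// ltW.
Qed.

Let rho01 : 0 <= rho < 1.
Proof.
have [_ _ [/andP[l0 l1] _] _ _] := DC.
by rewrite sqrtr_ge0 /= /rho -sqrtr1 ltr_sqrt.
Qed.

Lemma drift_sqrt_le x : (\int[T x]_y (S y)%:E <= (rho * S x + k)%:E)%E.
Proof.
have [r0 r1] := andP rho01.
apply: le_trans (drift_sqrt x) _; rewrite lee_fin lerD//.
  by rewrite ler_piMr ?mulr_ge0 ?sqrtr_ge0// indicE; case: (_ \in _).
by rewrite ler_piMr ?sqrtr_ge0// indicE; case: (_ \in _).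
Qed.

Lemma invariant_integrable_sqrt_drift : P.-integrable setT (EFin \o S).
Proof.
apply: (@invariant_integrable _ _ _ T P S rho k) => //.
- exact: measurable_sqrt_drift.
- by move=> x; exact: sqrtr_ge0.
- exact: sqrtr_ge0.
- exact: drift_sqrt_le.
Qed.

Let mSE : measurable_fun setT (fun y => (S y)%:E : \bar R).
Proof. by apply/measurable_EFinP; exact: measurable_sqrt_drift. Qed.

Lemma kernel_integrable_sqrt_drift x : (T x).-integrable setT (EFin \o S).
Proof.
apply/integrableP; split => //.
under eq_integral do rewrite /= ger0_norm ?sqrtr_ge0//.
by rewrite (le_lt_trans (drift_sqrt_le x))// ltry.
Qed.

(** At a point of [J] the measure [beta * nu] is below the transition
    probability, under which the square root of [V] is integrable. *)
Lemma small_measure_integrable_sqrt_drift : nu.-integrable setT (EFin \o S).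
Proof.
have [mJ PJ b0 minor] := SSC.
have [x Jx] : J !=set0.
  by apply/set0P/eqP => J0; move: PJ; rewrite J0 measure0 ltxx.
apply/integrableP; split => //.
under eq_integral do rewrite /= ger0_norm ?sqrtr_ge0//.
have : (beta%:E * \int[nu]_y (S y)%:E < +oo)%E.
  apply: le_lt_trans (ltry (rho * S x + k)); apply: le_trans (drift_sqrt_le x).
  pose bt := NngNum (ltW b0).
  rewrite -[beta]/(bt%:num) -ge0_integral_mscale//; last by move=> y _; rewrite lee_fin sqrtr_ge0.
  apply: ge0_le_measure_integral => //.
  - by move=> A mA; exact: minor.
  - by move=> y; rewrite lee_fin sqrtr_ge0.
by rewrite !ltey; apply: contra => /eqP ->; rewrite gt0_muley ?lte_fin.
Qed.

(** The weight W = S + e with e = sqrt b / beta satisfies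
    residual W <= rho S + e.  On [J] the left side is at most
    sqrt b + e - beta e = e; off [J] it is T S + e.  As W <= (1 + e) S, the right
    side is W - (1 - rho) S <= (1 - (1 - rho) / (1 + e)) W. *)
Lemma drift_poisson_equation : exists2 C : R, 0 < C & forall c g,
  dominated S c g -> \int[P]_x g x = 0 ->
  exists2 u, dominated S (C * c) u & forall x, u x = g x + \int[T x]_y u y.
Proof.
have [mJ PJ b0 minor] := SSC.
have [r0 r1] := andP rho01.
have r10 : 0 < 1 - rho by rewrite subr_gt0.
(* The smallest [e] for which the loss [beta * e] on [J] outweighs [k]. *)
pose e := k / beta.
have e0 : 0 <= e by rewrite divr_ge0 ?sqrtr_ge0// ltW.
have e1 : 0 < 1 + e by rewrite ltr_pwDl.
pose W x := S x + e.
have SW x : S x <= W x by rewrite lerDl.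
have WS x : W x <= (1 + e) * S x.
  by rewrite mulrDl mul1r lerD2l ler_peMr// sqrt_drift_ge1.
have W0 x : 0 < W x by apply: lt_le_trans (SW x); apply: lt_le_trans (sqrt_drift_ge1 x).
have mW : measurable_fun setT W by apply: measurable_funD => //; exact: measurable_sqrt_drift.
have iW (mu : {measure set E -> \bar R}) : (mu setT = 1)%E ->
    mu.-integrable setT (EFin \o S) -> mu.-integrable setT (EFin \o W).
  move=> mu1T iS; apply: (@le_integrable _ _ _ mu setT measurableT _
    (fun x => (1 + e)%:E * (EFin \o S) x)%E).
  - exact/measurable_EFinP.
  - move=> x _ /=; rewrite lee_fin gtr0_norm// (le_trans (WS x))// ler_norm//.
  - exact: integrableZl.
have iTW x : (T x).-integrable setT (EFin \o W).
  by apply: iW; [exact: prob_kernel|exact: kernel_integrable_sqrt_drift].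
have inuW : nu.-integrable setT (EFin \o W).
  by apply: iW; [exact: probability_setT|exact: small_measure_integrable_sqrt_drift].
have iPW : P.-integrable setT (EFin \o W).
  by apply: iW; [exact: probability_setT|exact: invariant_integrable_sqrt_drift].
pose rho' := 1 - (1 - rho) / (1 + e).
have rho'01 : 0 <= rho' < 1.
  rewrite /rho' subr_ge0 ltrBlDr ltrDl divr_gt0// andbT ler_pdivrMr// mul1r.
  by move: r0 e0; lra.
have drift x : residual T nu J beta W x <= rho' * W x.
  apply: (@le_trans _ _ (rho * S x + e)).
    have ET : \int[T x]_y W y = \int[T x]_y S y + e.
      rewrite RintegralD//; last 2 first.
      - exact: kernel_integrable_sqrt_drift.
      - by apply: integrable_cst_mass1; exact: prob_kernel.
      by rewrite Rintegral_cst_mass1//; exact: prob_kernel.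
    have Enu : e <= \int[nu]_y W y.
      rewrite RintegralD//; last 2 first.
      - exact: small_measure_integrable_sqrt_drift.
      - by apply: integrable_cst_mass1; exact: probability_setT.
      rewrite Rintegral_cst_mass1; last exact: probability_setT.
      rewrite lerDr.
      by apply: Rintegral_ge0 => y _; exact: sqrtr_ge0.
    have TS : \int[T x]_y S y <= rho * S x * \1_(~` J) x + k * \1_J x.
      rewrite -lee_fin /Rintegral fineK; first exact: drift_sqrt.
      by apply: integrable_fin_num => //; exact: kernel_integrable_sqrt_drift.
    rewrite /residual ET; move: TS; rewrite !indicE in_setC.
    case: (x \in J) => /=; rewrite ?mulr0 ?mulr1 ?add0r ?addr0 ?mul0r ?subr0 => TS.
      have : k <= beta * \int[nu]_y W y.
        rewrite -ler_pdivrMl// mulrC; exact: Enu.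
      have : 0 <= rho * S x by rewrite mulr_ge0 ?sqrtr_ge0.
      by move: TS; lra.
    by rewrite lerD2r.
  have h : (1 - rho) / (1 + e) * W x <= (1 - rho) * S x.
    by rewrite -mulrA ler_wpM2l ?(ltW r10)// ler_pdivrMl// WS.
  rewrite /rho' mulrBl mul1r -(lerD2r ((1 - rho) / (1 + e) * W x)) subrK.
  by rewrite (le_trans (lerD (lexx _) h))// /W; lra.
exists ((1 + e) / (1 - rho')).
  by rewrite divr_gt0// subr_gt0; case/andP: rho'01.
move=> c g [mg gS] Pg.
have hg : dominated W c g.
  split=> // x; have c0 : 0 <= c.
    rewrite -(@pmulr_lge0 _ (S x)) ?(le_trans _ (gS x))//.
    by rewrite (lt_le_trans _ (sqrt_drift_ge1 x)).
  by rewrite (le_trans (gS x))// ler_wpM2l.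
have [u hu uE] :=
  poisson_equation mJ b0 minor mW W0 iTW inuW rho'01 drift Tinv iPW PJ hg Pg.
exists u => //; have [mu uW] := hu; split=> // x.
apply: le_trans (uW x) _.
rewrite (_ : _ * S x = c / (1 - rho') * ((1 + e) * S x)); last by ring.
rewrite ler_wpM2l// divr_ge0//; last by rewrite subr_ge0 ltW//; case/andP: rho'01.
rewrite -(@pmulr_lge0 _ (S x)) ?(le_trans _ (gS x))//.
by rewrite (lt_le_trans _ (sqrt_drift_ge1 x)).
Qed.

End drift_poisson.

(** * Mean square error of ergodic averages *)

Section square_integrable.
Context d (Omega : measurableType d) (R : realType) (Q : probability Omega R).
Implicit Types X Y : Omega -> R.

Definition square_integrable X :=
  measurable_fun setT X /\ Q.-integrable setT (fun w => (X w ^+ 2)%:E).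

Lemma le_integrable_EFin X Y : measurable_fun setT X ->
  (forall w, `|X w| <= Y w) -> Q.-integrable setT (EFin \o Y) ->
  Q.-integrable setT (EFin \o X).
Proof.
move=> mX XY; apply: le_integrable => //; first exact/measurable_EFinP.
by move=> w _; rewrite lee_fin (le_trans (XY w))// ler_norm.
Qed.

Lemma square_integrableM X Y : square_integrable X -> square_integrable Y ->
  Q.-integrable setT (fun w => (X w * Y w)%:E).
Proof.
move=> [mX iX] [mY iY].
apply: (@le_integrable_EFin _ (fun w => X w ^+ 2 + Y w ^+ 2)).
- exact: measurable_funM.
- move=> w; rewrite ler_norml; apply/andP; split.
    by have := sqr_ge0 (X w + Y w); nra.
  by have := sqr_ge0 (X w - Y w); nra.
- exact: (integrableD measurableT iX iY).
Qed.

Lemma square_integrableD X Y : square_integrable X -> square_integrable Y ->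
  square_integrable (fun w => X w + Y w).
Proof.
move=> hX hY; have iXY := square_integrableM hX hY.
have [[mX iX] [mY iY]] := (hX, hY).
split; first exact: measurable_funD.
have h := integrableD measurableT (integrableD measurableT iX iY)
  (integrableZl measurableT 2 iXY).
apply: eq_integrable h => // w _ /=.
by rewrite -EFinM -!EFinD; congr EFin; ring.
Qed.

Lemma square_integrableN X : square_integrable X ->
  square_integrable (fun w => - X w).
Proof.
move=> [mX iX]; split; first exact: measurableT_comp.
by under eq_fun do rewrite sqrrN.
Qed.

Lemma square_integrable_sum (X : nat -> Omega -> R) n :
  (forall k, square_integrable (X k)) ->
  square_integrable (fun w => \sum_(k < n) X k w).
Proof.
move=> hX; elim: n => [|n ih].
  under eq_fun do rewrite big_ord0.
  split; first exact: measurable_cst.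
  under eq_fun do rewrite expr0n.
  exact: integrable0.
under eq_fun do rewrite big_ord_recr /=.
exact: square_integrableD.
Qed.

End square_integrable.

Section chain.
Context dE (E : measurableType dE) (R : realType).
Context dO (Omega : measurableType dO) (Q : probability Omega R)
  (Z : nat -> {RV Q >-> E}) (mu1 : probability E R) (T : R.-pker E ~> E).
Hypothesis Zchain : markov_chain Z mu1 T.

Let mZ n : measurable_fun setT (Z n) := measurable_funP (Z n).

Let ge0_markov_step k n (B : set E) (f : E -> \bar R) : (k <= n)%N -> measurable B ->
  measurable_fun setT f -> (forall x, 0 <= f x)%E ->
  (\int[Q]_(w in Z k @^-1` B) f (Z n.+1 w) =
   \int[Q]_(w in Z k @^-1` B) \int[T (Z n w)]_y f y)%E.
Proof.
move=> kn mB; apply: ge0_integral_comp_kernel => //.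
- by rewrite -[X in measurable X]setTI; exact: mZ.
- move=> A mA; apply: (Zchain.2) => //.
  by apply: sub_sigma_algebra; exists k, B.
Qed.

Lemma ge0_markov_next n (f : E -> \bar R) :
  measurable_fun setT f -> (forall x, 0 <= f x)%E ->
  (\int[Q]_w f (Z n.+1 w) = \int[Q]_w \int[T (Z n w)]_y f y)%E.
Proof.
move=> mf f0; have := ge0_markov_step (leqnn n) (@measurableT _ E) mf f0.
by rewrite preimage_setT.
Qed.

(** Only products of a function of one past state with a function of the next
    state are needed; the events Z_k in B with k <= n belong to the history up to
    time n, which gives the identity for indicators of the past state. *)
Lemma ge0_markov_product k n (phi : E -> \bar R) (f : E -> R) : (k <= n)%N ->
  measurable_fun setT phi -> (forall x, 0 <= phi x)%E ->
  measurable_fun setT f -> (forall x, 0 <= f x) ->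
  (forall x, (T x).-integrable setT (EFin \o f)) ->
  (\int[Q]_w (phi (Z k w) * (f (Z n.+1 w))%:E) =
   \int[Q]_w (phi (Z k w) * (\int[T (Z n w)]_y f y)%R%:E))%E.
Proof.
move=> kn mphi phi0 mf f0 iTf.
have mfE : measurable_fun setT (fun y => (f y)%:E : \bar R) by exact/measurable_EFinP.
have f0E y : (0 <= (f y)%:E)%E by rewrite lee_fin.
have ET x : (\int[T x]_y f y)%:E = (\int[T x]_y (f y)%:E)%E.
  by rewrite /Rintegral fineK// integrable_fin_num.
apply: (@ge0_integralM_comp _ _ _ _ _ _ (Z k) (fun w => f (Z n.+1 w))
  (fun w => \int[T (Z n w)]_y f y)) => //.
- exact: measurableT_comp.
- apply/measurable_EFinP; rewrite (_ : _ \o _ =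
      (fun x => \int[T x]_y (f y)%:E)%E \o Z n); last by apply/funext => w /=; rewrite ET.
  by apply: measurableT_comp => //; exact: ge0_measurable_kernel_integral.
- by move=> w; exact: Rintegral_ge0.
move=> B mB; rewrite (ge0_markov_step kn mB mfE f0E).
by apply: eq_integral => w _; rewrite ET.
Qed.

End chain.

Section chain_variance.
Context dE (E : measurableType dE) (R : realType).
Context dO (Omega : measurableType dO) (Q : probability Omega R)
  (Z : nat -> {RV Q >-> E}) (T : R.-pker E ~> E)
  (P mu1 nu : probability E R) (J : set E) (beta lambda b : R) (V : E -> R).
Hypotheses (Zchain : markov_chain Z mu1 T) (Tinv : invariant T P)
  (SSC : small_set_condition T P J beta nu)
  (DC : drift_condition T mu1 J V lambda b).

Let S x := Num.sqrt (V x).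
Let M := b / (1 - lambda).

Let mZ n : measurable_fun setT (Z n) := measurable_funP (Z n).
Let mV : measurable_fun setT V. Proof. by case: DC. Qed.
Let V_ge1 x : 1 <= V x. Proof. by case: DC. Qed.
Let V_ge0 x : 0 <= V x. Proof. exact: le_trans (V_ge1 x). Qed.
Let mS : measurable_fun setT S := measurable_sqrt_drift DC.
Let S_ge1 x : 1 <= S x := sqrt_drift_ge1 DC x.
Let S_gt0 x : 0 < S x. Proof. exact: lt_le_trans (S_ge1 x). Qed.
Let iTS x : (T x).-integrable setT (EFin \o S) := kernel_integrable_sqrt_drift DC x.

Let mVE : measurable_fun setT (fun x => (V x)%:E : \bar R).
Proof. exact/measurable_EFinP. Qed.

(** The bound b / (1 - lambda) is the fixed point of M |-> lambda M + b, and
    one transition maps moments below it to moments below it. *)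
Lemma drift_moment n : (\int[Q]_w (V (Z n w))%:E <= M%:E)%E.
Proof.
have [_ _ [/andP[l0 l1] b0] TV mu1V] := DC.
have [Z0 Zn] := Zchain.
elim: n => [|n ih].
  move: mu1V; rewrite unlock; apply: le_trans.
  rewrite -(@ge0_integral_distribution _ _ _ _ _ Q (Z 0%N) (EFin \o V))//.
  rewrite le_eqVlt; apply/orP; left; apply/eqP.
  by apply: eq_measure_integral => A mA _; exact: Z0.
rewrite (ge0_markov_next Zchain n mVE); last by move=> x; rewrite lee_fin.
have mZE k : measurable_fun setT (fun w => (V (Z k w))%:E : \bar R).
  exact: measurableT_comp mVE (mZ k).
apply: (@le_trans _ _ (\int[Q]_w (lambda%:E * (V (Z n w))%:E + b%:E))%E).
  apply: ge0_le_integral => //.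
  - by move=> w _; apply: integral_ge0 => y _; rewrite lee_fin.
  - apply: (@measurableT_comp _ _ _ _ _ _ (fun x => \int[T x]_y (V y)%:E)%E) => //.
    by apply: ge0_measurable_kernel_integral => // y; rewrite lee_fin.
  - by apply: emeasurable_funD => //; exact: measurable_funeM.
  move=> w _; rewrite (le_trans (TV _))// -EFinM -EFinD lee_fin lerD//.
    by rewrite ler_piMr ?mulr_ge0// ?(ltW l0)// indicE; case: (_ \in _).
  by rewrite ler_piMr ?(ltW b0)// indicE; case: (_ \in _).
rewrite ge0_integralD//; first last.
- by move=> w _; rewrite lee_fin ltW.
- exact: measurable_funeM.
- by move=> w _; rewrite -EFinM lee_fin mulr_ge0// ltW.
rewrite integral_cst_mass1; last exact: probability_setT.
rewrite ge0_integralZl_EFin//; last 2 first.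
- by move=> w _; rewrite lee_fin.
- exact: ltW.
apply: le_trans (leeD2r _ (lee_wpmul2l _ ih)) _.
  by rewrite lee_fin ltW.
rewrite -EFinM -EFinD lee_fin le_eqVlt; apply/orP; left; apply/eqP.
by rewrite /M; field; rewrite subr_eq0 gt_eqF.
Qed.

Lemma dominated_square_integrable n c f : dominated S c f ->
  square_integrable Q (f \o Z n) /\ \int[Q]_w (f (Z n w)) ^+ 2 <= c ^+ 2 * M.
Proof.
move=> [mf fS].
have f2 x : f x ^+ 2 <= c ^+ 2 * V x.
  rewrite -[V x]sqr_sqrtr// -exprMn -[leLHS]real_normK ?num_real//.
  by rewrite ler_sqr ?nnegrE// (le_trans _ (fS x)).
have iV : Q.-integrable setT (fun w => (V (Z n w))%:E).
  apply/integrableP; split; first exact: (measurableT_comp mVE (mZ n)).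
  under eq_integral do rewrite gee0_abs ?lee_fin//.
  by rewrite (le_lt_trans (drift_moment n))// ltry.
have icV : Q.-integrable setT (fun w => (c ^+ 2 * V (Z n w))%:E).
  exact: (integrableZl measurableT (c ^+ 2) iV).
have mfZ : measurable_fun setT (f \o Z n) by exact: measurableT_comp.
have if2 : Q.-integrable setT (fun w => (f (Z n w) ^+ 2)%:E).
  apply: le_integrable_EFin icV; first exact: measurable_funX.
  by move=> w; rewrite ger0_norm ?sqr_ge0.
split => //.
apply: (@le_trans _ _ (\int[Q]_w (c ^+ 2 * V (Z n w)))).
  exact: le_Rintegral.
rewrite RintegralZl// ler_wpM2l ?sqr_ge0//.
rewrite -lee_fin /Rintegral fineK ?drift_moment//.
exact: integrable_fin_num.
Qed.

Lemma dominated_kernel c f : dominated S c f ->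
  dominated S (c * (Num.sqrt lambda + Num.sqrt b)) (fun x => \int[T x]_y f y).
Proof.
move=> hf; split; first exact: (measurable_Rintegral_kernel mS S_gt0 iTS hf).
move=> x; have iTf := dominated_integrable (iTS x) hf.
apply: le_trans (le_normr_Rintegral measurableT iTf) _.
have [mf fS] := hf.
have c0 : 0 <= c by rewrite -(pmulr_lge0 _ (S_gt0 x)) (le_trans _ (fS x)).
apply: (@le_trans _ _ (\int[T x]_y (c * S y))).
  apply: le_Rintegral => //; first exact: integrable_norm.
  exact: (integrableZl measurableT c (iTS x)).
rewrite RintegralZl// -mulrA ler_wpM2l//.
apply: (@le_trans _ _ (Num.sqrt lambda * S x + Num.sqrt b)).
  rewrite -lee_fin /Rintegral fineK; first exact: (drift_sqrt_le DC).
  exact: integrable_fin_num.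
by rewrite mulrDl lerD2l ler_peMr// sqrtr_ge0.
Qed.

Let si n c f (hf : dominated S c f) := (dominated_square_integrable n hf).1.

(** The Markov property for a product; it is bilinear in [phi] and [f], so that
    the signed case reduces to the nonnegative one by adding multiples of [S]. *)
Let step k n f phi := \int[Q]_w (phi (Z k w) * f (Z n.+1 w)) =
  \int[Q]_w (phi (Z k w) * \int[T (Z n w)]_y f y).

Let stepBl k n a a' c f phi psi : dominated S a phi -> dominated S a' psi ->
  dominated S c f -> step k n f phi -> step k n f psi ->
  step k n f (fun x => phi x - psi x).
Proof.
move=> hphi hpsi hf e1 e2; rewrite /step.
have hTf := dominated_kernel hf.
under eq_Rintegral do rewrite mulrBl.
rewrite RintegralB//; last 2 first.
- exact: (square_integrableM (si k hphi) (si n.+1 hf)).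
- exact: (square_integrableM (si k hpsi) (si n.+1 hf)).
under [RHS]eq_Rintegral do rewrite mulrBl.
rewrite RintegralB//; last 2 first.
- exact: (square_integrableM (si k hphi) (si n hTf)).
- exact: (square_integrableM (si k hpsi) (si n hTf)).
by rewrite e1 e2.
Qed.

Let stepBr k n a c c' f g phi : dominated S a phi -> dominated S c f ->
  dominated S c' g -> step k n f phi -> step k n g phi ->
  step k n (fun x => f x - g x) phi.
Proof.
move=> hphi hf hg e1 e2; rewrite /step.
have hTf := dominated_kernel hf; have hTg := dominated_kernel hg.
under eq_Rintegral do rewrite mulrBr.
rewrite RintegralB//; last 2 first.
- exact: (square_integrableM (si k hphi) (si n.+1 hf)).
- exact: (square_integrableM (si k hphi) (si n.+1 hg)).
under [RHS]eq_Rintegral.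
  move=> w _; rewrite RintegralB//; last 2 first.
  - exact: (dominated_integrable (iTS _) hf).
  - exact: (dominated_integrable (iTS _) hg).
  rewrite mulrBr; over.
rewrite RintegralB//; last 2 first.
- exact: (square_integrableM (si k hphi) (si n hTf)).
- exact: (square_integrableM (si k hphi) (si n hTg)).
by rewrite e1 e2.
Qed.

(** The martingale property of the increments: u(Z_(n+1)) - T u (Z_n) is
    orthogonal to every dominated function of a state up to time [n]. *)
Lemma markov_product k n a c phi f : (k <= n)%N ->
  dominated S a phi -> dominated S c f ->
  \int[Q]_w (phi (Z k w) * f (Z n.+1 w)) =
  \int[Q]_w (phi (Z k w) * \int[T (Z n w)]_y f y).
Proof.
move=> kn.
have hS := dominated_weight mS S_gt0.
have step0 a' c' phi' f' : dominated S a' phi' -> dominated S c' f' ->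
    (forall x, 0 <= phi' x) -> (forall x, 0 <= f' x) -> step k n f' phi'.
  move=> [mphi _] hf phi0 f0; rewrite /step /Rintegral; congr fine.
  have [mf _] := hf.
  apply: (@ge0_markov_product _ _ _ _ _ _ _ _ _ Zchain k n (EFin \o phi') f') => //.
  - exact/measurable_EFinP.
  - by move=> x; exact: (dominated_integrable (iTS x) hf).
have shift e h : dominated S e h ->
    [/\ dominated S (e + `|e| * 1) (fun x => h x + e * S x),
    dominated S (`|e| * 1) (fun x => e * S x),
    forall x, 0 <= h x + e * S x & forall x, 0 <= e * S x].
  move=> hh; have heS := dominatedZ e hS; split => //.
  - exact: dominatedD.
  - move=> x; have [_ /(_ x)] := hh; rewrite ler_norml => /andP[+ _].
    by rewrite -subr_ge0 opprK.
  - by move=> x; have [_ /(_ x)] := hh; apply: le_trans.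
have stepr a' c' phi' f' : dominated S a' phi' -> dominated S c' f' ->
    (forall x, 0 <= phi' x) -> step k n f' phi'.
  move=> hphi hf phi0; have [h1 h2 p1 p2] := shift _ _ hf.
  rewrite (_ : f' = fun x => (f' x + c' * S x) - c' * S x).
    by apply: (stepBr hphi h1 h2); [exact: step0 hphi h1 _ _|exact: step0 hphi h2 _ _].
  by apply/funext => x; rewrite addrK.
move=> hphi hf; have [h1 h2 p1 p2] := shift _ _ hphi.
rewrite -/(step k n f phi) (_ : phi = fun x => (phi x + a * S x) - a * S x).
  by apply: (stepBl h1 h2 hf); [exact: stepr h1 hf _|exact: stepr h2 hf _].
by apply/funext => x; rewrite addrK.
Qed.

Let M_ge0 : 0 <= M.
Proof.
have [_ _ [/andP[_ l1] b0] _ _] := DC.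
by rewrite divr_ge0 ?ltW// subr_gt0.
Qed.

(** Since u = g + T u, passing from [n] to [n.+1] adds
    D_n = u(Z_(n+1)) - T u (Z_n), which is orthogonal to the previous terms, so
    the second moments of the D_n add up. *)
Lemma poisson_partial_sum_sqr a c u g : dominated S a u -> dominated S c g ->
  (forall x, u x = g x + \int[T x]_y u y) ->
  forall n, let Y w := \sum_(k < n) g (Z k w) + u (Z n w) in
    \int[Q]_w (Y w) ^+ 2 <= n.+1%:R * (2 * (a ^+ 2 + (a + c) ^+ 2) * M).
Proof.
move=> hu hg uE.
have hTu := dominatedB hu hg.
have TuE x : \int[T x]_y u y = u x - g x by rewrite [in RHS]uE addrAC subrr add0r.
pose Y n w := \sum_(k < n) g (Z k w) + u (Z n w).
pose D n w := u (Z n.+1 w) - (u (Z n w) - g (Z n w)).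
have YS n w : Y n.+1 w = Y n w + D n w.
  by rewrite /Y /D big_ord_recr /=; ring.
have sS n : square_integrable Q (fun w => \sum_(k < n) g (Z k w)).
  by apply: (@square_integrable_sum _ _ _ _ (fun k w => g (Z k w))) => k; exact: si hg.
have sY n : square_integrable Q (Y n) by apply: square_integrableD => //; exact: si hu.
have sD n : square_integrable Q (D n).
  by apply: square_integrableD; [exact: si hu|apply: square_integrableN; exact: si hTu].
have orth k n e phi : (k <= n)%N -> dominated S e phi ->
    \int[Q]_w (phi (Z k w) * D n w) = 0.
  move=> kn hphi; rewrite /D.
  under eq_Rintegral do rewrite mulrBr.
  rewrite RintegralB//; last 2 first.
  - exact: (square_integrableM (si k hphi) (si n.+1 hu)).
  - exact: (square_integrableM (si k hphi) (si n hTu)).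
  rewrite (markov_product kn hphi hu); apply/eqP; rewrite subr_eq0; apply/eqP.
  by apply: eq_Rintegral => w _; rewrite TuE.
have sumD n m : (m <= n.+1)%N ->
    \int[Q]_w ((\sum_(k < m) g (Z k w)) * D n w) = 0.
  elim: m => [|m ih] mn.
    under eq_Rintegral do rewrite big_ord0 mul0r.
    by rewrite Rintegral_cst_mass1//; exact: probability_setT.
  under eq_Rintegral do rewrite big_ord_recr /= mulrDl.
  rewrite RintegralD//; last 2 first.
  - exact: (square_integrableM (sS m) (sD n)).
  - exact: (square_integrableM (si m hg) (sD n)).
  by rewrite ih ?(ltnW mn)// add0r (orth _ _ _ _ _ hg).
have YD n : \int[Q]_w (Y n w * D n w) = 0.
  rewrite /Y; under eq_Rintegral do rewrite mulrDl.
  rewrite RintegralD//; last 2 first.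
  - exact: (square_integrableM (sS n) (sD n)).
  - exact: (square_integrableM (si n hu) (sD n)).
  by rewrite (orth _ _ _ _ (leqnn n) hu) addr0 sumD.
have D2 n : \int[Q]_w (D n w) ^+ 2 <= 2 * (a ^+ 2 + (a + c) ^+ 2) * M.
  have i1 := (si n.+1 hu).2; have i2 := (si n hTu).2.
  have i12 := integrableD measurableT i1 i2.
  apply: (@le_trans _ _ (\int[Q]_w
      (2 * ((u (Z n.+1 w)) ^+ 2 + (u (Z n w) - g (Z n w)) ^+ 2)))).
    apply: le_Rintegral => //.
    - exact: (sD n).2.
    - exact: (integrableZl measurableT 2 i12).
    move=> w _; rewrite /D; move: (u (Z n.+1 w)) (u (Z n w) - g (Z n w)) => x y.
    by have := sqr_ge0 (x + y); nra.
  rewrite RintegralZl// RintegralD// -mulrA ler_wpM2l// mulrDl.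
  by rewrite lerD//; [exact: (dominated_square_integrable n.+1 hu).2
                     |exact: (dominated_square_integrable n hTu).2].
move=> n /=; rewrite -/(Y n); elim: n => [|n ih].
  rewrite /Y; under eq_Rintegral do rewrite big_ord0 add0r.
  apply: le_trans (dominated_square_integrable 0 hu).2 _.
  rewrite mul1r ler_wpM2r//.
  by have := sqr_ge0 (a + c); have := sqr_ge0 a; lra.
have -> : \int[Q]_w (Y n.+1 w) ^+ 2 = \int[Q]_w (Y n w) ^+ 2 + \int[Q]_w (D n w) ^+ 2.
  have iYD := square_integrableM (sY n) (sD n).
  have i2YD := integrableZl measurableT 2 iYD.
  under eq_Rintegral do rewrite YS sqrrD -mulr_natl.
  rewrite RintegralD//; last 2 first.
  - exact: (integrableD measurableT (sY n).2 i2YD).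
  - exact: (sD n).2.
  rewrite RintegralD//; last exact: (sY n).2.
  by rewrite RintegralZl// YD mulr0 addr0.
by rewrite -natr1 mulrDl mul1r lerD.
Qed.

(** The constant is obtained from the centred function g - P g, which is
    dominated with constant c (1 + P S), by subtracting the boundary term u(Z_N)
    from the sum controlled above. *)
Lemma markov_mean_square_error : exists2 D : R, 0 < D & forall c g N,
  dominated S c g -> (0 < N)%N ->
  (\int[Q]_w ((N%:R^-1 * (\sum_(k < N) g (Z k w)) - \int[P]_x g x)%R ^+ 2)%:E <=
   (c ^+ 2 * D / N%:R)%:E)%E.
Proof.
have [C C0 poisson] := drift_poisson_equation Tinv SSC DC.
have iPS : P.-integrable setT (EFin \o S) := invariant_integrable_sqrt_drift Tinv DC.
pose m := \int[P]_x S x.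
have m0 : 0 <= m by apply: Rintegral_ge0 => x _; exact: ltW.
pose q := 1 + m.
have q0 : 0 < q by rewrite ltr_pwDl.
(* The square of the sum over k < N is at most twice the square of the sum with
   boundary term u(Z_N), hence the factor 2 (N + 1) <= 4 N, plus twice u(Z_N)^2;
   adding 1 makes the constant positive. *)
exists (4 * (2 * ((C * q) ^+ 2 + (C * q + q) ^+ 2) * M) + 2 * (C * q) ^+ 2 * M + 1).
  apply: ltr_wpDl => //; apply: addr_ge0.
    by rewrite mulr_ge0// mulr_ge0// mulr_ge0// addr_ge0 ?sqr_ge0.
  by rewrite mulr_ge0// mulr_ge0// sqr_ge0.
move=> c g N hg N0.
have c0 : 0 <= c.
  by have [_ /(_ point)] := hg => gS; rewrite -(pmulr_lge0 _ (S_gt0 point)) (le_trans _ gS).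
have iPg := dominated_integrable iPS hg.
pose l := \int[P]_x g x.
have lm : `|l| <= c * m.
  apply: le_trans (le_normr_Rintegral measurableT iPg) _.
  rewrite -RintegralZl//; apply: le_Rintegral => //.
  - exact: integrable_norm.
  - exact: (integrableZl measurableT c iPS).
  - by move=> x _; case: hg.
have hl : dominated S (c * m) (cst l).
  split=> [|x]; first exact: measurable_cst.
  by rewrite (le_trans lm)// ler_peMr// mulr_ge0.
have hgl : dominated S (c * q) (fun x => g x - l).
  by rewrite /q mulrDr mulr1; exact: (dominatedB hg hl).
have [|u hu uE] := poisson _ _ hgl.
  rewrite RintegralB//; last exact: (dominated_integrable iPS hl).
  by rewrite Rintegral_cst_mass1 ?subrr//; exact: probability_setT.
have := poisson_partial_sum_sqr hu hgl uE N.
set Y := (fun w => _ + u (Z N w)).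
pose A w := \sum_(k < N) (g (Z k w) - l).
set a := C * (c * q); set K := 2 * _ * M => YK.
have sA : square_integrable Q A.
  by apply: (@square_integrable_sum _ _ _ _ (fun k w => g (Z k w) - l)) => k; exact: si hgl.
have sY : square_integrable Q Y by exact: (square_integrableD sA (si N hu)).
have [su Mu] := dominated_square_integrable N hu.
have N_gt0 : 0 < N%:R :> R by rewrite ltr0n.
have AK : \int[Q]_w (A w) ^+ 2 <= 2 * (N.+1%:R * K) + 2 * (a ^+ 2 * M).
  have i1 := integrableZl measurableT 2 sY.2; have i2 := integrableZl measurableT 2 su.2.
  apply: (@le_trans _ _ (\int[Q]_w (2 * (Y w) ^+ 2 + 2 * (u (Z N w)) ^+ 2))).
    apply: le_Rintegral => //.
    - exact: sA.2.
    - exact: (integrableD measurableT i1 i2).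
    move=> w _; rewrite -(addrK (u (Z N w)) (A w)) -/(Y w); move: (Y w) (u (Z N w)) => x y.
    by have := sqr_ge0 (x + y); nra.
  rewrite RintegralD// RintegralZl//; last exact: sY.2.
  rewrite RintegralZl//; last exact: su.2.
  by rewrite lerD// ler_wpM2l.
have FA w : N%:R^-1 * (\sum_(k < N) g (Z k w)) - l = N%:R^-1 * A w.
  rewrite /A sumrB sumr_const card_ord mulrBr -[l *+ N]mulr_natl mulKf//.
  by rewrite gt_eqF.
under eq_integral do rewrite FA exprMn.
have iA : Q.-integrable setT (fun w => (N%:R^-1 ^+ 2 * A w ^+ 2)%:E).
  exact: (integrableZl measurableT _ sA.2).
have -> : (\int[Q]_w (N%:R^-1 ^+ 2 * A w ^+ 2)%:E =
    (\int[Q]_w (N%:R^-1 ^+ 2 * A w ^+ 2)%R)%R%:E)%E.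
  by rewrite /Rintegral fineK// integrable_fin_num.
rewrite lee_fin RintegralZl//; last exact: sA.2.
set K1 := 2 * ((C * q) ^+ 2 + (C * q + q) ^+ 2) * M.
set U := (C * q) ^+ 2 * M.
have KK1 : K = c ^+ 2 * K1 by rewrite /K /K1 /a; ring.
have aU : a ^+ 2 * M = c ^+ 2 * U by rewrite /U /a; ring.
have N_ge1 : 1 <= N%:R :> R by rewrite ler1n.
have K1_ge0 : 0 <= c ^+ 2 * K1.
  by rewrite mulr_ge0 ?sqr_ge0// mulr_ge0// mulr_ge0// addr_ge0 ?sqr_ge0.
have U_ge0 : 0 <= c ^+ 2 * U by rewrite mulr_ge0 ?sqr_ge0// mulr_ge0 ?sqr_ge0.
have AN : \int[Q]_w (A w) ^+ 2 <= N%:R * (c ^+ 2 * (4 * K1 + 2 * U + 1)).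
  apply: le_trans AK _; rewrite KK1 aU -[N.+1%:R]natr1.
  have := sqr_ge0 c; move: K1_ge0 U_ge0 N_ge1.
  rewrite (_ : c ^+ 2 * (_ + _) = 4 * (c ^+ 2 * K1) + 2 * (c ^+ 2 * U) + c ^+ 2); last by ring.
  move: (c ^+ 2 * K1) (c ^+ 2 * U) (c ^+ 2) (N%:R) => k v e n k0 v0 n1 e0.
  have n10 : 0 <= n - 1 by rewrite subr_ge0.
  by have := mulr_ge0 k0 n10; have := mulr_ge0 v0 n10; have := mulr_ge0 e0 n10; lra.
apply: (@le_trans _ _ (N%:R^-1 ^+ 2 * (N%:R * (c ^+ 2 * (4 * K1 + 2 * U + 1))))).
  by rewrite ler_wpM2l// sqr_ge0.
rewrite -/K1 -[2 * (C * q) ^+ 2 * M]mulrA -/U le_eqVlt; apply/orP; left; apply/eqP.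
by field; rewrite gt_eqF.
Qed.

End chain_variance.

(** * Integrated errors of the kernel density estimator *)

Section kde_error.
Context (R : realType) (d : nat).
Context dO (Omega : measurableType dO) (Q : probability Omega R)
  (Z : nat -> {RV Q >-> 'rV[R]_d}) (T : R.-pker 'rV[R]_d ~> 'rV[R]_d)
  (P mu1 nu : probability 'rV[R]_d R) (J : set 'rV[R]_d)
  (beta lambda b : R) (K V : 'rV[R]_d -> R).
Hypotheses (Zchain : markov_chain Z mu1 T) (Tinv : invariant T P)
  (SSC : small_set_condition T P J beta nu)
  (DC : drift_condition T mu1 J V lambda b)
  (mK : measurable_fun setT K).

Let S x := Num.sqrt (V x).

Lemma measurable_scaled_kernel h x : measurable_fun setT (scaled_kernel K h x).
Proof.
apply: measurable_funM => //; apply: measurableT_comp => //.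
apply: measurable_fun_rV => i.
rewrite (_ : (fun _ => _) = fun y : 'rV[R]_d => h^-1 * (x ord0 i - y ord0 i)).
  apply: measurable_funM => //; apply: measurable_funB => //.
  exact: measurable_coord.
by apply/funext => y; rewrite !mxE.
Qed.

(** The integrand of the moment condition of order [r] is the [r]-th power of the
    smallest [c] with |K_h(x, .)| <= c sqrt V. *)
Lemma kernel_moment_dominated (r : nat) (c : R) h x :
  (0 < r)%N ->
  (forall y, `|scaled_kernel K h x y| ^+ r * V y `^ (- (r%:R / 2)) <= c ^+ r) ->
  0 <= c -> dominated S c (scaled_kernel K h x).
Proof.
move=> r0 hc c0; split; first exact: measurable_scaled_kernel.
move=> y; have Vy : 0 < V y by apply: lt_le_trans (_ : 1 <= V y); case: DC.
rewrite -(@ler_pXn2r _ r)// ?nnegrE ?mulr_ge0// ?sqrtr_ge0// exprMn.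
have -> : S y ^+ r = V y `^ (r%:R / 2).
  by rewrite /S -powR12_sqrt ?ltW// -powR_mulrn ?powR_ge0// -powRrM mulrC.
have := hc y; rewrite powRN ler_pdivrMr// powR_gt0//.
Qed.

Let err h N w x := kde K h N (fun k => Z k w) x - mean_kernel P K h x.

Lemma kde_errE h N w x : err h N w x =
  N%:R^-1 * (\sum_(k < N) scaled_kernel K h x (Z k w)) - \int[P]_y scaled_kernel K h x y.
Proof. by rewrite /err /kde /mean_kernel [@expectation]unlock. Qed.

Lemma measurable_kde_err h N x : measurable_fun setT (fun w => err h N w x).
Proof.
under eq_fun do rewrite kde_errE.
apply: measurable_funB => //; apply: measurable_funM => //.
apply: measurable_sum => k.
by apply: measurableT_comp; [exact: measurable_scaled_kernel|exact: measurable_funP].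
Qed.

(** Where the supremum is infinite there is nothing to prove; elsewhere it
    provides the constant of domination of [scaled_kernel K h x], the supremum
    itself for the order 1 and its square root for the order 2. *)
Lemma kde_integrated_errors : exists2 D : R, 0 < D &
  forall N h, (0 < N)%N ->
  (\int[lebesgue_rV d]_x 'E_Q[fun w => `|err h N w x|%R] <=
    (Num.sqrt (D / N%:R))%:E * \int[lebesgue_rV d]_x
      ereal_sup [set (`|scaled_kernel K h x y| ^+ 1 *
        V y `^ (- (1%:R / 2)))%:E | y in setT])%E /\
  (\int[lebesgue_rV d]_x 'E_Q[fun w => (err h N w x ^+ 2)%R] <=
    (D / N%:R)%:E * \int[lebesgue_rV d]_x
      ereal_sup [set (`|scaled_kernel K h x y| ^+ 2 *
        V y `^ (- (2%:R / 2)))%:E | y in setT])%E.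
Proof.
have [D D0 mse] := markov_mean_square_error Zchain Tinv SSC DC.
exists D => // N h N0.
have DN : 0 < D / N%:R by rewrite divr_gt0// ltr0n.
have sup0 (r : nat) x : (0 <= ereal_sup [set (`|scaled_kernel K h x y| ^+ r *
    V y `^ (- (r%:R / 2)))%:E | y in setT])%E.
  apply: (@le_trans _ _ (`|scaled_kernel K h x 0| ^+ r * V 0 `^ (- (r%:R / 2)))%:E).
    by rewrite lee_fin mulr_ge0 ?exprn_ge0 ?powR_ge0.
  by apply: ereal_sup_ubound; exists 0.
have supP (r : nat) x (c : R) : (0 < r)%N ->
    ereal_sup [set (`|scaled_kernel K h x y| ^+ r *
      V y `^ (- (r%:R / 2)))%:E | y in setT] = (c ^+ r)%:E ->
    0 <= c -> dominated S c (scaled_kernel K h x).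
  move=> r0 sc c0; apply: (@kernel_moment_dominated r) => // y.
  by rewrite -lee_fin -sc; apply: ereal_sup_ubound; exists y.
have E2 x c : dominated S c (scaled_kernel K h x) ->
    (\int[Q]_w (err h N w x ^+ 2)%:E <= (c ^+ 2 * D / N%:R)%:E)%E.
  by move=> hc; under eq_integral do rewrite kde_errE; exact: mse.
split; apply: ge0_le_integralZl => //.
- by move=> x; rewrite [@expectation]unlock; apply: integral_ge0 => w _; rewrite lee_fin.
- move=> x; rewrite [@expectation]unlock; have := supP 1%N x; have := sup0 1%N x.
  case: (ereal_sup _) => [M1||] //.
    rewrite lee_fin => M0 /(_ M1 isT) /(_ erefl M0) /E2 e2.
    rewrite -EFinM; apply: expectation_le_sqrt.
    + exact: probability_setT.
    + exact: measurable_kde_err.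
    + by rewrite mulr_ge0 ?sqrtr_ge0.
    + by rewrite exprMn sqr_sqrtr ?(ltW DN)// mulrC mulrA.
  by move=> _ _; rewrite gt0_muley ?leey// lte_fin sqrtr_gt0.
- exact: ltW.
- by move=> x; rewrite [@expectation]unlock; apply: integral_ge0 => w _; rewrite lee_fin sqr_ge0.
- move=> x; rewrite [@expectation]unlock; have := supP 2%N x; have := sup0 2%N x.
  case: (ereal_sup _) => [M2||] //.
    rewrite lee_fin => M0 /(_ (Num.sqrt M2) isT).
    rewrite sqr_sqrtr// => /(_ erefl (sqrtr_ge0 _)) /E2.
    by rewrite sqr_sqrtr// -EFinM -mulrA [(M2 * _)%R]mulrC.
  by move=> _ _; rewrite gt0_muley ?leey// lte_fin.
Qed.

End kde_error.

Unset Implicit Arguments.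

Theorem theorem5p10 (R : realType) (d : nat) (d_gt0 : (0 < d)%N)
  (P : probability 'rV[R]_d R) (p K : 'rV[R]_d -> R) (hN : nat -> R)
  (Pp : has_density P p) (p_gt0 : forall x, 0 < p x)
  (Kcond : kernel_condition K) (hcond : bandwidth_condition d hN)
  (pcond : density_condition p)
  (dO : measure_display) (Omega : measurableType dO) (Q : probability Omega R)
  (Z : nat -> {RV Q >-> 'rV[R]_d}) (mu1 : probability 'rV[R]_d R)
  (T : R.-pker 'rV[R]_d ~> 'rV[R]_d)
  (Zchain : markov_chain Z mu1 T)
  (Tinv : invariant T P) (Tirr : irreducible T P) (Taper : aperiodic T P)
  (Tharris : harris_recurrent T P)
  (J : set 'rV[R]_d) (beta : R) (nu : probability 'rV[R]_d R)
  (V : 'rV[R]_d -> R) (lambda b : R)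
  (SSC : small_set_condition T P J beta nu)
  (DC : drift_condition T mu1 J V lambda b)
  (B1 B2 B4 : R)
  (K4 : K \in Lfun (lebesgue_rV d) 4%:E)
  (KMC1 : kernel_moment_bound K V 1 B1)
  (KMC2 : kernel_moment_bound K V 2 B2)
  (KMC4 : kernel_moment_bound K V 4 B4) :
  exists alpha0 alpha1 : R, [/\ 0 < alpha0, 0 < alpha1 &
    forall (N : nat) (h : R), (0 < N)%N -> 0 < h <= 1 ->
      let err w x := kde K h N (fun k => Z k w) x - mean_kernel P K h x in
      (\int[lebesgue_rV d]_x 'E_Q[fun w => `|err w x|%R] <=
        (alpha0 * lnorm 1 K / Num.sqrt N%:R
         + alpha0 * B1 / (Num.sqrt N%:R * h ^+ d)
         + 2 * alpha1 * lnorm 2 K ^+ 2 / (N%:R * h ^+ d)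
         + 2 * alpha1 * B2 / (N%:R * h ^+ (2 * d)))%:E)%E /\
      (\int[lebesgue_rV d]_x 'E_Q[fun w => (err w x ^+ 2)%R] <=
        (4 * alpha0 ^+ 2 * lnorm 2 K ^+ 2 / (N%:R * h ^+ d)
         + 4 * alpha0 ^+ 2 * B2 / (N%:R * h ^+ (2 * d))
         + 8 * alpha1 ^+ 2 * lnorm 4 K ^+ 4 / (N%:R ^+ 2 * h ^+ (3 * d))
         + 8 * alpha1 ^+ 2 * B4 / (N%:R ^+ 2 * h ^+ (4 * d)))%:E)%E].
Proof.
have [mJ _ _ _] := SSC.
have mK : measurable_fun setT K.
  by have [_ [K1 _] _ _ _] := Kcond; move: K1; rewrite inE => /andP[]; rewrite inE.
have [D D0 bounds] := kde_integrated_errors Zchain Tinv SSC DC mK.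
have lnorm_ge0 q : 0 <= lnorm q K by rewrite fine_ge0// Lnorm_ge0.
have [B1_gt0 KB1] := KMC1; have [B2_gt0 KB2] := KMC2; have [B4_gt0 _] := KMC4.
exists (Num.sqrt D), 1; split => //; first by rewrite sqrtr_gt0.
move=> N h N0 h01 err; have [h0 _] := andP h01.
have N_gt0 : 0 < N%:R :> R by rewrite ltr0n.
have hX_neq0 m : h ^+ m != 0 by rewrite expf_neq0// gt_eqF.
have DN : 0 <= D / N%:R by rewrite divr_ge0// ltW.
have [e1 e2] := bounds N h N0; split.
  apply: le_trans e1 _.
  apply: le_trans (lee_wpmul2l _ (KB1 h h01)) _; first by rewrite lee_fin sqrtr_ge0.
  rewrite -EFinM lee_fin mul1n sqrtrM ?(ltW D0)// sqrtrV ?(ltW N_gt0)//.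
  have -> : Num.sqrt D / Num.sqrt N%:R * (B1 / h ^+ d) =
      Num.sqrt D * B1 / (Num.sqrt N%:R * h ^+ d).
    by field; rewrite hX_neq0 gt_eqF// sqrtr_gt0.
  have t1 : 0 <= Num.sqrt D * lnorm 1 K / Num.sqrt N%:R.
    by rewrite !mulr_ge0 ?invr_ge0 ?sqrtr_ge0.
  have t3 : 0 <= 2 * 1 * lnorm 2 K ^+ 2 / (N%:R * h ^+ d).
    by rewrite divr_ge0 ?mulr_ge0 ?exprn_ge0// ltW.
  have t4 : 0 <= 2 * 1 * B2 / (N%:R * h ^+ (2 * d)).
    by rewrite divr_ge0 ?mulr_ge0 ?exprn_ge0// ltW.
  by move: t1 t3 t4; lra.
apply: le_trans e2 _.
apply: le_trans (lee_wpmul2l _ (KB2 h h01)) _; first by rewrite lee_fin.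
rewrite -EFinM lee_fin sqr_sqrtr ?(ltW D0)//.
have t0 : D / N%:R * (B2 / h ^+ (2 * d)) = D * B2 / (N%:R * h ^+ (2 * d)).
  by field; rewrite hX_neq0 gt_eqF.
have t1 : 0 <= 4 * D * lnorm 2 K ^+ 2 / (N%:R * h ^+ d).
  by rewrite divr_ge0 ?mulr_ge0 ?exprn_ge0// ltW.
have t2 : 0 <= D * B2 / (N%:R * h ^+ (2 * d)).
  by rewrite divr_ge0 ?mulr_ge0 ?exprn_ge0// ltW.
have t3 : 0 <= 8 * 1 ^+ 2 * lnorm 4 K ^+ 4 / (N%:R ^+ 2 * h ^+ (3 * d)).
  by rewrite divr_ge0 ?mulr_ge0 ?exprn_ge0// ltW.
have t4 : 0 <= 8 * 1 ^+ 2 * B4 / (N%:R ^+ 2 * h ^+ (4 * d)).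
  by rewrite divr_ge0 ?mulr_ge0 ?exprn_ge0// ltW.
rewrite t0 (_ : 4 * D * B2 / _ = 4 * (D * B2 / (N%:R * h ^+ (2 * d)))); last by ring.
by move: t1 t2 t3 t4; lra.
Qed.
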